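(* Let $S\subset\mathbb{R}^3$ be an irreducible, algebraic, real, parabolic affine rotation surface whose Gaussian curvature is not identically zero. Then $S$ has either one, or two, or infinitely many parabolic axes of rotation. Furthermore, if $S$ has more than one parabolic axis of rotation, then there exists a similarity mapping $S$ onto a level surface of $F(x,y,z)=y^2-2xz+wx^2$, with $w\in\mathbb{R}$, where $w\neq0$ if $S$ has two parabolic axes of rotation, and $w=0$ if $S$ has infinitely many parabolic axes of rotation.
   Context: An algebraic surface is the zero set of a polynomial in $x,y,z$ with real coefficients; real means that its real part is 2-dimensional. $S$ is a parabolic affine rotation surface about a line $\mathcal{A}$, and $\mathcal{A}$ is a parabolic axis of rotation of $S$, if there is a rigid motion $T$ of $\mathbb{R}^3$ carrying $\mathcal{A}$ to the $z$-axis such that $T(S)$ is invariant, for all $\alpha\in\mathbb{R}$, under the matrices $\begin{pmatrix}1&0&0\\ \alpha&1&0\\ \alpha^2/2&\alpha&1\end{pmatrix}$. $S$ is a parabolic affine rotation surface if it has at least one parabolic axis of rotation. A level surface of $F$ is a set $\{F=\delta\}$ with $\delta\in\mathbb{R}$. *)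

(* Defs.v *)
(* The multinomials library is imported
   without its notations, some of which clash with those of MathComp-Analysis;
   mpoly 3 R is the type usually displayed as {mpoly R[3]}. *)
From HB Require Import structures.
From mathcomp Require Import all_boot all_order all_algebra.
From mathcomp Require Import boolp classical_sets functions cardinality reals.
From mathcomp Require Import topology normedtype.
From mathcomp Require Import -(notations) mpoly.

Set Implicit Arguments.
Unset Strict Implicit.
Unset Printing Implicit Defensive.

Import Order.TTheory GRing.Theory Num.Theory.
Import numFieldNormedType.Exports.
Local Open Scope classical_set_scope.
Local Open Scope ring_scope.

(* Points and vectors of R^3 are column vectors: coordinates x, y, z are the
   entries of index 0, 1, 2, and matrices act on the left. *)
Section ParabolicSurfaces.
Variable R : realType.

Definition dot (u v : 'cV[R]_3) : R := (u^T *m v) 0 0.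

Definition peval (f : mpoly 3 R) (p : 'cV[R]_3) : R :=
  meval (fun i => p i 0) f.

Definition zero_set (f : mpoly 3 R) : set 'cV[R]_3 :=
  [set p | peval f p = 0].

(* Irreducibility in R[x,y,z]; the units are the nonzero constants. *)
Definition irreducible_mpoly (f : mpoly 3 R) : Prop :=
  [/\ f != 0, f \isn't a GRing.unit &
      forall g h : mpoly 3 R, f = g * h ->
        (g \is a GRing.unit) || (h \is a GRing.unit)].

Definition cube (k : nat) : set 'cV[R]_k :=
  [set t | forall i, 0 <= t i 0 <= 1].

(* By compactness of the cube, g is a homeomorphism onto its image. *)
Definition contains_cell (S : set 'cV[R]_3) (k : nat) : Prop :=
  exists g : 'cV[R]_k -> 'cV[R]_3,
    [/\ {within @cube k, continuous g}, set_inj (@cube k) g &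
        g @` @cube k `<=` S].

(* The dimension of a (semi)algebraic set is the largest k such that the set
   contains a topologically embedded k-dimensional cell. *)
Definition has_dimension (S : set 'cV[R]_3) (d : nat) : Prop :=
  contains_cell S d /\ forall k, contains_cell S k -> (k <= d)%N.

Definition grad (f : mpoly 3 R) (p : 'cV[R]_3) : 'cV[R]_3 :=
  \col_i peval (mderiv i f) p.

Definition hess (f : mpoly 3 R) (p : 'cV[R]_3) : 'M[R]_3 :=
  \matrix_(i, j) peval (mderiv j (mderiv i f)) p.

Definition regular_point (f : mpoly 3 R) (p : 'cV[R]_3) : Prop :=
  zero_set f p /\ grad f p != 0.

Definition tangent (f : mpoly 3 R) (p u : 'cV[R]_3) : Prop :=
  dot (grad f p) u = 0.

(* For the unit normal N = grad f / |grad f| and tangent vectors u, v, the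
   second fundamental form - <dN(u), v> equals - <Hess f u, v> / |grad f|: the
   term coming from the derivative of 1 / |grad f| is normal to the surface. *)
Definition second_form (f : mpoly 3 R) (p u v : 'cV[R]_3) : R :=
  - dot (hess f p *m u) v / Num.sqrt (dot (grad f p) (grad f p)).

(* K = det II / det I in one, equivalently any, basis of the tangent plane;
   pairs u, v that are linearly dependent give 0 = K * 0.  At a regular point
   the tangent plane is 2-dimensional, so K exists and is unique. *)
Definition gaussian_curvature (f : mpoly 3 R) (p : 'cV[R]_3) (K : R) :
    Prop :=
  forall u v, tangent f p u -> tangent f p v ->
    second_form f p u u * second_form f p v v - second_form f p u v ^+ 2 =
    K * (dot u u * dot v v - dot u v ^+ 2).

Definition curvature_not_identically_zero (f : mpoly 3 R) : Prop :=
  exists p K, [/\ regular_point f p, gaussian_curvature f p K & K != 0].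

Definition rigid_motion (T : 'cV[R]_3 -> 'cV[R]_3) : Prop :=
  exists (A : 'M[R]_3) (b : 'cV[R]_3),
    [/\ A^T *m A = 1%:M, \det A = 1 & forall p, T p = A *m p + b].

Definition similarity (T : 'cV[R]_3 -> 'cV[R]_3) : Prop :=
  exists (c : R) (A : 'M[R]_3) (b : 'cV[R]_3),
    [/\ 0 < c, A^T *m A = 1%:M & forall p, T p = c *: (A *m p) + b].

Definition is_line (L : set 'cV[R]_3) : Prop :=
  exists p v : 'cV[R]_3, v != 0 /\ L = range (fun t : R => p + t *: v).

Definition z_axis : set 'cV[R]_3 :=
  [set p | p 0 0 = 0 /\ p 1 0 = 0].

Definition parabolic_mx (a : R) : 'M[R]_3 :=
  \matrix_(i, j) nth 0 (nth [::] [:: [:: 1         ; 0; 0];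
                                     [:: a         ; 1; 0];
                                     [:: a ^+ 2 / 2; a; 1]] i) j.

Definition parabolic_axis (S L : set 'cV[R]_3) : Prop :=
  is_line L /\
  exists T : 'cV[R]_3 -> 'cV[R]_3,
    [/\ rigid_motion T, T @` L = z_axis &
        forall a : R, (fun p => parabolic_mx a *m p) @` (T @` S) = T @` S].

Definition parabolic_axes (S : set 'cV[R]_3) : set (set 'cV[R]_3) :=
  [set L | parabolic_axis S L].

Definition parabolic_rotation_surface (S : set 'cV[R]_3) : Prop :=
  exists L, parabolic_axis S L.

Definition model_form (w : R) (p : 'cV[R]_3) : R :=
  let x := p 0 0 in let y := p 1 0 in let z := p 2%:R 0 in
  y ^+ 2 - 2 * x * z + w * x ^+ 2.

Definition level_surface (F : 'cV[R]_3 -> R) (delta : R) : set 'cV[R]_3 :=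
  [set p | F p = delta].

End ParabolicSurfaces.

(* Main.v *)
Require Import Defs.
From HB Require Import structures.
From mathcomp Require Import all_boot all_order all_algebra.
From mathcomp Require Import boolp classical_sets functions cardinality reals.
From mathcomp Require Import topology normedtype.
From mathcomp Require Import -(notations) mpoly.
From mathcomp Require Import ring lra.

Set Implicit Arguments.
Unset Strict Implicit.
Unset Printing Implicit Defensive.

Import Order.TTheory GRing.Theory Num.Theory.
Import numFieldNormedType.Exports.
Local Open Scope classical_set_scope.
Local Open Scope card_scope.
Local Open Scope ring_scope.

(** The matrices of a parabolic rotation are the exponentials of [a N], where
    N is nilpotent with N e1 = e2, N e2 = e3 and N e3 = 0; the vector field
    N p = (0, x, y) vanishes exactly on the z-axis, and x and y^2 - 2 x z are
    invariant.  Move S so that its given axis is the z-axis.  A second axis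
    gives a second one-parameter group on S, generated by an affine field
    X p = n p + v with n conjugate to N by a rotation, and this axis is the
    zero set of X ([parabolic_axis_flow]).

    Conjugating the second group by the first one, the field
    exp (- t N) X (exp (t N) p) is tangent to S at p for every t
    ([conj_field_tangent]).  Its normal component is a polynomial of degree 4
    in t, and its five coefficients vanish at every p in S: linear relations
    between the entries of n and v, with coefficients that depend on p
    ([tangency_relations]).  Imposing them at two points of S with different
    abscissas leaves two cases ([second_rotation_shape]).  Either X is a
    multiple of N, and the axes coincide, or X preserves some quadratic
    polynomial Q = y^2 - 2 x z - 2 a x + w x^2 ([quad_flow]).  In the second
    case the two groups sweep out of one point of S enough points of a level
    surface of Q, and irreducibility of f makes S that level surface
    ([irreducible_quadric]); adding a to z turns Q into the model form.

    The level surface determines a and w.  If w <> 0, the fact that n is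
    conjugate to N by an orthogonal matrix forces the second axis to be one
    definite line ([second_axis_kernel]), so that there are exactly two axes.
    If w = 0 the surface is, up to translation, the surface of revolution
    y^2 - 2 x z = d, and turning the z-axis about its axis of revolution gives
    infinitely many parabolic axes ([infinite_cone_axes]).

    The two points with different abscissas, and a nonzero z-derivative of f
    at each, come from the curvature.  At a point of nonzero curvature the
    Hessian bordered by the gradient is invertible ([curved_point_exists]); its
    determinant is a polynomial, so the condition can be used as a factor.
    The only piece of analysis is [vanishing_tangent]: a polynomial that
    vanishes on the zero set of f has zero derivative along the tangent plane
    at each regular point.  If a polynomial such as x (x - x0) times the
    bordered determinant vanished on S, differentiating it along S would
    contradict the invertibility of the bordered Hessian. *)

(** * Polynomial functions and their first-order expansion *)

Local Notation coord i := (mpolyX _ (mnm1 i)).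

(** Polynomials are generated as a ring by constants and variables; identities
    between ring morphisms and derivations are proved along this induction. *)
Lemma mpoly_ring_ind (n : nat) (R : comNzRingType) (P : mpoly n R -> Prop) :
  (forall c, P (mpolyC n c)) -> (forall i, P (coord i)) ->
  (forall p q, P p -> P q -> P (p + q)) ->
  (forall p q, P p -> P q -> P (p * q)) -> forall p, P p.
Proof.
move=> PC PX PD PM; elim/mpolyind=> [|c m p _ _ Pp].
  by rewrite -(mpolyC0 n R); apply: PC.
apply: PD => //; rewrite -mul_mpolyC; apply: (PM) => //.
rewrite mpolyXE_id; have P1 : P 1 by rewrite -(mpolyC1 n R); apply: PC.
apply: (big_ind P) => [//|x y Px Py|i _]; first exact: PM.
by elim: (m i) => [|k IHk]; rewrite ?expr0 // exprS; apply: PM.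
Qed.

Lemma sum_ord3 (V : nmodType) (F : 'I_3 -> V) :
  \sum_i F i = F 0 + F 1 + F 2%:R.
Proof.
rewrite !big_ord_recl big_ord0 addr0 addrA.
by congr (_ + F _ + F _); apply: val_inj.
Qed.

Lemma ord3P (P : 'I_3 -> Prop) : P 0 -> P 1 -> P 2%:R -> forall i, P i.
Proof.
move=> P0 P1 P2 [[|[|[|//]]] Hi]; [move: P0|move: P1|move: P2];
  by congr P; apply: val_inj.
Qed.

Lemma colP3 (V : Type) (u v : 'cV[V]_3) :
  u 0 0 = v 0 0 -> u 1 0 = v 1 0 -> u 2%:R 0 = v 2%:R 0 -> u = v.
Proof. by move=> h0 h1 h2; apply/colP; apply: ord3P. Qed.

Section PolynomialFunctions.
Variable R : realType.
Implicit Types (f g h : mpoly 3 R) (p u v s : 'cV[R]_3).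

Lemma pevalD f g p : peval (f + g) p = peval f p + peval g p.
Proof. exact: mevalD. Qed.
Lemma pevalM f g p : peval (f * g) p = peval f p * peval g p.
Proof. exact: mevalM. Qed.
Lemma pevalN f p : peval (- f) p = - peval f p.
Proof. exact: mevalN. Qed.
Lemma pevalB f g p : peval (f - g) p = peval f p - peval g p.
Proof. exact: mevalB. Qed.
Lemma pevalC c p : peval (mpolyC 3 c) p = c.
Proof. exact: mevalC. Qed.
Lemma pevalX i p : peval (coord i) p = p i 0.
Proof. exact: mevalXU. Qed.
Lemma peval1 p : peval 1 p = 1.
Proof. exact: meval1. Qed.

Lemma peval_sum (I : finType) (F : I -> mpoly 3 R) p :
  peval (\sum_i F i) p = \sum_i peval (F i) p.
Proof. exact: raddf_sum. Qed.

Definition pevalE := (pevalD, pevalB, pevalM, pevalN, pevalC, pevalX, peval1).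

Lemma dotE u v : dot u v = u 0 0 * v 0 0 + u 1 0 * v 1 0 + u 2%:R 0 * v 2%:R 0.
Proof. by rewrite /dot mxE sum_ord3 !mxE. Qed.

Lemma dotDr u v w : dot u (v + w) = dot u v + dot u w.
Proof. by rewrite /dot mulmxDr mxE. Qed.
Lemma dotZr u a v : dot u (a *: v) = a * dot u v.
Proof. by rewrite /dot -scalemxAr mxE. Qed.

Lemma dot_ge0 u : 0 <= dot u u.
Proof. by rewrite dotE; nra. Qed.

Lemma dot_gt0 u : u != 0 -> 0 < dot u u.
Proof.
move=> u0; rewrite lt_neqAle dot_ge0 andbT; apply: contraNneq u0 => /esym d0.
by move: d0; rewrite dotE => d0; apply/eqP/colP3; rewrite mxE; nra.
Qed.

Lemma mderiv_coord (i j : 'I_3) :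
  mderiv i (coord j) = ((j == i)%:R : mpoly 3 R).
Proof.
rewrite mderivX mnm1E; case: eqP => [->|_]; last by rewrite scale0r.
rewrite scale1r (_ : mnm_sub _ _ = mnm0) ?mpolyX0 //.
by apply/mnmP => k; rewrite mnmBE subnn mnm0E.
Qed.

Lemma peval_mderiv_coord (i j : 'I_3) p :
  peval (mderiv i (coord j)) p = (nat_of_ord j == i)%:R.
Proof. by rewrite mderiv_coord /peval rmorph_nat. Qed.

Definition bounded_on (A : Type) (D : set A) (F : A -> R) :=
  exists C, forall x, D x -> `|F x| <= C.

Lemma bounded_onD (A : Type) (D : set A) F G :
  bounded_on D F -> bounded_on D G -> bounded_on D (fun x => F x + G x).
Proof.
move=> [C HC] [C' HC']; exists (C + C') => x Dx.
by rewrite (le_trans (ler_normD _ _)) // lerD ?HC ?HC'.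
Qed.

Lemma bounded_onM (A : Type) (D : set A) F G :
  bounded_on D F -> bounded_on D G -> bounded_on D (fun x => F x * G x).
Proof.
move=> [C HC] [C' HC']; exists (C * C') => x Dx.
by rewrite normrM ler_pM ?HC ?HC'.
Qed.

Lemma bounded_on_cst (A : Type) (D : set A) c : bounded_on D (fun=> c : R).
Proof. by exists `|c|. Qed.

(** The remainder is bounded uniformly in the direction, which is what allows
    the direction to vary in [vanishing_tangent].  It is built along with the
    polynomial: the remainder of a product is a polynomial expression in the
    remainders and derivatives of the factors. *)
Lemma taylor2 f p (W : R) :
  exists2 rho : R * 'cV[R]_3 -> R,
    bounded_on [set x : R * 'cV[R]_3 | `|x.1| <= 1 /\ forall i, `|x.2 i 0| <= W] rho &
    forall e w,
      peval f (p + e *: w) = peval f p + e * dot (grad f p) w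
                             + e ^+ 2 * rho (e, w).
Proof.
set D := [set x | _].
have bfst : bounded_on D fst by exists 1 => x [].
have bdot a : bounded_on D (fun x => dot a x.2).
  have bx i : bounded_on D (fun x => x.2 i 0) by exists W => x [_]; apply.
  have -> : (fun x : R * 'cV[R]_3 => dot a x.2) = fun x =>
      a 0 0 * x.2 0 0 + a 1 0 * x.2 1 0 + a 2%:R 0 * x.2 2%:R 0.
    by apply/funext => x; rewrite dotE.
  by do ![apply: bounded_onD | apply: bounded_onM | exact: bounded_on_cst
         | exact: bx].
elim/mpoly_ring_ind: f =>
  [c|i|f g [r br Er] [r' br' Er']|f g [r br Er] [r' br' Er']].
- exists (fun=> 0) => [|e w]; first exact: bounded_on_cst.
  by rewrite !pevalC dotE !mxE !mderivC -!(mpolyC0 3 R) !pevalC; ring.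
- exists (fun=> 0) => [|e w]; first exact: bounded_on_cst.
  rewrite !pevalX !mxE mulr0 addr0 /dot; congr (_ + e * _).
  rewrite mxE (bigD1 i) //= big1 => [|j ji]; rewrite !mxE peval_mderiv_coord.
    by rewrite eqxx mul1r addr0.
  by rewrite eq_sym (_ : (_ == _) = false) ?mul0r //; apply: negPf.
- exists (fun x => r x + r' x) => [|e w]; first exact: bounded_onD.
  have -> : grad (f + g) p = grad f p + grad g p.
    by apply/colP => i; rewrite !mxE mderivD pevalD.
  by rewrite !pevalD Er Er' !dotE !mxE; ring.
- have E u : dot (grad (f * g) p) u
      = dot (grad f p) u * peval g p + peval f p * dot (grad g p) u.
    by rewrite !dotE !mxE !mderivM !pevalD !pevalM; ring.
  exists (fun x => peval f p * r' x + peval g p * r x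
     + dot (grad f p) x.2 * dot (grad g p) x.2
     + x.1 * (dot (grad f p) x.2 * r' x + r x * dot (grad g p) x.2)
     + x.1 * x.1 * (r x * r' x)).
    by do ![apply: bounded_onD | apply: bounded_onM | exact: bounded_on_cst
           | exact: bdot | done].
  by move=> e w; rewrite !pevalM Er Er' E /=; ring.
Qed.

End PolynomialFunctions.

(** * Functions vanishing on a surface *)

Section VanishingOnSurface.
Variable R : realType.
Implicit Types (f g h : mpoly 3 R) (p u v s : 'cV[R]_3).

Lemma vec_bounded v : exists W : R, forall i, `|v i 0| <= W.
Proof.
exists (`|v 0 0| + `|v 1 0| + `|v 2%:R 0|).
apply: ord3P; have := normr_ge0 (v 0 0); have := normr_ge0 (v 1 0);
  have := normr_ge0 (v 2%:R 0); lra.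
Qed.

Lemma small_factor (a b : R) : 0 < a ->
  exists e, [/\ 0 < e, e <= 1 & e * `|b| <= a].
Proof.
move=> a0; have b0 := normr_ge0 b; have ab0 : 0 < a + `|b| by lra.
exists (a / (a + `|b|)); split; first exact: divr_gt0.
  by rewrite ler_pdivrMr // mul1r lerDl.
by rewrite mulrAC ler_pdivrMr // ler_wpM2l ?(ltW a0) // lerDr (ltW a0).
Qed.

(** Only curves of this quadratic form are needed: the orbits of a parabolic
    rotation are such curves. *)
Lemma dir_deriv_eq0 f p u v :
  (forall e, peval f (p + e *: (u + e *: v)) = 0) -> dot (grad f p) u = 0.
Proof.
move=> f0.
have [Wu Hu] := vec_bounded u; have [Wv Hv] := vec_bounded v.
have [rho [C HC] E] := taylor2 f p (Wu + Wv).
have fp0 : peval f p = 0 by have := f0 0; rewrite scale0r addr0.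
set A := dot (grad f p) u; set B := dot (grad f p) v.
apply/eqP; apply: contraT; rewrite -normr_gt0 => A0.
have [|e [e0 e1 eBC]] := @small_factor (`|A| / 2) (`|B| + `|C|).
  by rewrite divr_gt0.
rewrite ger0_norm ?addr_ge0 // in eBC.
have := f0 e; rewrite E fp0 add0r dotDr dotZr -/A -/B => Z.
have : e * (A + e * (B + rho (e, u + e *: v))) = 0 by rewrite -Z; ring.
move/eqP; rewrite mulf_eq0 gt_eqF //= => /eqP {}Z.
have rC : `|rho (e, u + e *: v)| <= `|C|.
  apply: le_trans (ler_norm _); apply: HC; split => /= [|i].
    by rewrite gtr0_norm.
  rewrite !mxE (le_trans (ler_normD _ _)) // lerD // normrM gtr0_norm //.
  by apply: le_trans (Hv i); rewrite ler_piMl.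
have : `|A| <= e * (`|B| + `|C|).
  have -> : A = - (e * (B + rho (e, u + e *: v))) by lra.
  rewrite normrN normrM gtr0_norm // ler_wpM2l ?(ltW e0) //.
  by rewrite (le_trans (ler_normD _ _)) // lerD.
lra.
Qed.

Definition on_line f p v : {poly R} :=
  mmap (@polyC R) (fun i => (p i 0)%:P + v i 0 *: 'X) f.

Lemma on_lineE f p v t : (on_line f p v).[t] = peval f (p + t *: v).
Proof.
elim/mpoly_ring_ind: f => [c|i|f g|f g]; rewrite /on_line.
- by rewrite mmapC hornerC pevalC.
- by rewrite mmapX mmap1U pevalX !hornerE !mxE mulrC.
- by rewrite mmapD hornerD pevalD => -> ->.
- by rewrite rmorphM hornerM pevalM => -> ->.
Qed.

(** For e small, f changes sign on the short segment from p + e (u - eta d) to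
    p + e (u + eta d), where d is the gradient, since u is tangent; the
    intermediate value theorem puts on it a zero of f, hence of h.  Dividing
    h by e there leaves the derivative of h along u up to an error that is
    small with eta and e.  This weak form of the statement that the surface is
    smooth at p spares the implicit function theorem. *)
Lemma vanishing_tangent f h p u :
  peval f p = 0 -> grad f p != 0 -> dot (grad f p) u = 0 ->
  (forall s, peval f s = 0 -> peval h s = 0) -> dot (grad h p) u = 0.
Proof.
move=> fp0 /dot_gt0; move Ed : (grad f p) => d k0 gu0 fh.
have [Wu Hu] := vec_bounded u; have [Wd Hd] := vec_bounded d.
have [rf [Cf HCf] Ef] := taylor2 f p (Wu + Wd).
have [rh [Ch HCh] Eh] := taylor2 h p (Wu + Wd).
move: k0; move Ek : (dot d d) => k k0.
move EA : (dot (grad h p) u) => A; move EB : (dot (grad h p) d) => B.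
apply/eqP; apply: contraT; rewrite -normr_gt0 => A0.
have [|eta [eta0 eta1 etaB]] := @small_factor (`|A| / 4) B.
  by rewrite divr_gt0.
have etak0 : 0 < eta * k by rewrite mulr_gt0.
have [|e [e0 e1]] :=
    @small_factor (Num.min (`|A| / 4) (eta * k)) (`|Cf| + `|Ch|).
  by rewrite lt_min etak0 divr_gt0.
(* eA serves the estimate on h, ek the sign change of f *)
rewrite ger0_norm ?addr_ge0 // mulrDr le_min => /andP[eA ek].
have eC0 (C : R) : 0 <= e * `|C| by rewrite mulr_ge0 // ltW.
have dom (t : R) : `|t| <= eta ->
    `|e| <= 1 /\ forall i, `|(u + t *: d) i 0| <= Wu + Wd.
  move=> t1; split=> [|i]; first by rewrite gtr0_norm.
  rewrite !mxE (le_trans (ler_normD _ _)) // lerD // normrM.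
  by apply: le_trans (Hd i); rewrite ler_piMl // (le_trans t1).
have bound (C t : R) (r : R * 'cV[R]_3 -> R) :
    (forall x : R * 'cV[R]_3, `|x.1| <= 1 /\ (forall i, `|x.2 i 0| <= Wu + Wd) ->
       `|r x| <= C) ->
    `|t| <= eta -> `|e * r (e, u + t *: d)| <= e * `|C|.
  move=> HC te; rewrite normrM gtr0_norm // ler_wpM2l ?(ltW e0) //.
  by apply: le_trans (ler_norm _); apply: HC; apply: dom te.
have Ff t :
    peval f (p + e *: (u + t *: d)) = e * (t * k + e * rf (e, u + t *: d)).
  by rewrite Ef fp0 Ed add0r dotDr gu0 dotZr add0r Ek; ring.
have line t : p + e *: u + t *: (e *: d) = p + e *: (u + t *: d).
  by apply/colP => i; rewrite !mxE; ring.
have [t te ft] : exists2 t, `|t| <= eta & peval f (p + e *: (u + t *: d)) = 0.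
  have ivt : - eta <= eta by lra.
  have [|t te /rootP] :=
    poly_ivt (p := on_line f (p + e *: u) (e *: d)) ivt.
    rewrite !on_lineE !line !Ff pmulr_rle0 // pmulr_rge0 //.
    have n1 : `|- eta| <= eta by rewrite normrN gtr0_norm.
    have n2 : `|eta| <= eta by rewrite gtr0_norm.
    have := bound _ _ _ HCf n1; have := bound _ _ _ HCf n2.
    have := eC0 Ch; rewrite !ler_norml => c0 /andP[a1 a2] /andP[b1 b2].
    by apply/andP; split; lra.
  by rewrite on_lineE line; exists t => //; rewrite ler_norml.
have := fh _ ft; rewrite Eh (fh p fp0) add0r dotDr dotZr EA EB => Z.
have : e * (A + t * B + e * rh (e, u + t *: d)) = 0 by rewrite -Z; ring.
move/eqP; rewrite mulf_eq0 gt_eqF //= => /eqP {}Z.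
have := bound _ _ _ HCh te; have := eC0 Cf.
have : `|A| <= eta * `|B| + `|e * rh (e, u + t *: d)|.
  have -> : A = - (t * B + e * rh (e, u + t *: d)) by lra.
  rewrite normrN (le_trans (ler_normD _ _)) // lerD // normrM.
  by rewrite ler_wpM2r.
lra.
Qed.

End VanishingOnSurface.

(** * Nonzero curvature and affine changes of coordinates *)

Section CurvedPoints.
Variable R : realType.
Implicit Types (f g h : mpoly 3 R) (p u v s : 'cV[R]_3).

Definition bordered_mx f : 'M[mpoly 3 R]_(3 + 1) :=
  block_mx (\matrix_(i, j) mderiv j (mderiv i f)) (\col_i mderiv i f)
           (\row_i mderiv i f) 0.

(** Up to a nonzero factor this determinant is the Gaussian curvature; being
    polynomial in the point it can multiply another polynomial. *)
Definition bordered f : mpoly 3 R := \det (bordered_mx f).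

Definition curved f p := peval (bordered f) p != 0.

Lemma dotC u v : dot u v = dot v u.
Proof. by rewrite !dotE; ring. Qed.

Lemma hess_sym f p : (hess f p)^T = hess f p.
Proof. by apply/matrixP => i j; rewrite !mxE mderiv_comm. Qed.

Lemma peval_bordered f p :
  peval (bordered f) p =
  \det (block_mx (hess f p) (grad f p) (grad f p)^T (0 : 'M_1)).
Proof.
rewrite /bordered /peval -det_map_mx /bordered_mx map_block_mx; 
congr (\det (block_mx _ _ _ _)).
- by apply/matrixP => i j; rewrite !mxE.
- by apply/matrixP => i j; rewrite !mxE.
- by apply/matrixP => i j; rewrite !mxE.
- by apply/matrixP => i j; rewrite !mxE raddf0.
Qed.

(** The kernel of the bordered matrix consists of the tangent vectors u whose
    image under the Hessian is normal, that is, of the null directions of the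
    second fundamental form. *)
Lemma curvedP f p : curved f p <->
  forall u (s : R), dot (grad f p) u = 0 ->
    hess f p *m u + s *: grad f p = 0 -> u = 0 /\ s = 0.
Proof.
rewrite /curved peval_bordered; set M := block_mx _ _ _ _.
have mulM u (t : 'M_1) : M *m col_mx u t =
    col_mx (hess f p *m u + t 0 0 *: grad f p) (dot (grad f p) u)%:M.
  rewrite mul_block_col mul0mx addr0; congr col_mx.
    congr (_ + _); apply/matrixP => i j.
    by rewrite !mxE big_ord1 !ord1 !mxE mulrC.
  by apply/matrixP => i j; rewrite !ord1 !mxE eqxx mulr1n /dot mxE.
split=> [M0 u s gu0 Hu|H].
  have Mu : M \in unitmx by rewrite unitmxE unitfE.
  have := mulM u s%:M; rewrite gu0 mxE eqxx mulr1n Hu raddf0 col_mx0.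
  move=> /(congr1 (mulmx (invmx M))).
  rewrite mulmx0 mulKmx // -(col_mx0 R 3 1) => /eq_col_mx[-> /matrixP/(_ 0 0)].
  by rewrite !mxE eqxx mulr1n.
apply/negP => /det0P[v v0 vM].
have : M *m v^T = 0.
  rewrite -(trmxK M) -trmx_mul (_ : M^T = M) ?vM ?trmx0 //.
  by rewrite tr_block_mx trmxK hess_sym trmx0.
rewrite -[v^T]vsubmxK mulM -(col_mx0 R 3 1) => /eq_col_mx[Hu gu].
have [] := H _ _ _ Hu.
  by move/matrixP: gu => /(_ 0 0); rewrite !mxE eqxx mulr1n.
move=> u0 s0; case/eqP: v0; apply: trmx_inj; rewrite trmx0 -[v^T]vsubmxK u0.
rewrite -(col_mx0 R 3 1); congr col_mx.
by apply/matrixP => i j; rewrite !ord1 s0 mxE.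
Qed.

Lemma curved_regular f p : curved f p -> grad f p != 0.
Proof.
move=> /curvedP/(_ 0 1) H; apply/eqP => g0.
move: H; rewrite g0 mulmx0 scaler0 addr0 dotE !mxE !mulr0 !addr0.
by case=> // _ /eqP; rewrite oner_eq0.
Qed.

(** A null direction u of the second fundamental form makes det II vanish in
    the basis formed by u and any tangent vector orthogonal to it. *)
Lemma curved_point_exists f : curvature_not_identically_zero f ->
  exists2 p, peval f p = 0 & curved f p.
Proof.
move=> [p [K [[fp0 g0] HK K0]]]; exists p => //.
apply/curvedP => u s gu Hu.
suff u0 : u = 0.
  split=> //; move: Hu; rewrite u0 mulmx0 add0r => /eqP.
  by rewrite scaler_eq0 (negPf g0) orbF => /eqP.
apply/eqP; apply: contraT => u0.
set g := grad f p in g0 gu Hu *.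
(* the cross product of g and u completes u to a tangent basis *)
pose v : 'cV[R]_3 := \col_i nth 0 [:: g 1 0 * u 2%:R 0 - g 2%:R 0 * u 1 0;
    g 2%:R 0 * u 0 0 - g 0 0 * u 2%:R 0; g 0 0 * u 1 0 - g 1 0 * u 0 0] i.
have gv : dot g v = 0 by rewrite dotE !mxE /=; ring.
have uv : dot u v = 0 by rewrite dotE !mxE /=; ring.
have vv : dot v v = dot g g * dot u u.
  have : dot v v = dot g g * dot u u - dot g u ^+ 2.
    by rewrite !dotE !mxE /=; ring.
  by rewrite gu expr0n subr0.
have II w : dot g w = 0 -> second_form f p u w = 0.
  move=> gw; rewrite /second_form.
  have -> : hess f p *m u = - s *: g.
    by apply/eqP; rewrite scaleNr -addr_eq0 Hu.
  by rewrite dotC dotZr dotC gw mulr0 oppr0 mul0r.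
have := HK u v gu gv; rewrite !II // mul0r expr0n uv expr0n !subr0 vv.
move/esym/eqP; rewrite !mulf_eq0 (negPf K0) !gt_eqF ?dot_gt0 //.
Qed.

Definition var_col : 'cV[mpoly 3 R]_3 := \col_i coord i.

Definition affine_subst (A : 'M[R]_3) (b : 'cV[R]_3) f : mpoly 3 R :=
  mmap (@mpolyC 3 R)
    (fun i => (map_mx (@mpolyC 3 R) A *m var_col + map_mx (@mpolyC 3 R) b) i 0)
    f.

Variables (A : 'M[R]_3) (b : 'cV[R]_3).
Local Notation sub := (affine_subst A b).

Lemma affine_subst_coordE i : sub (coord i) =
  (map_mx (@mpolyC 3 R) A *m var_col + map_mx (@mpolyC 3 R) b) i 0.
Proof. by rewrite /affine_subst mmapX mmap1U. Qed.

Lemma affine_subst_coord i : sub (coord i) =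
  \sum_j mpolyC 3 (A i j) * coord j + mpolyC 3 (b i 0).
Proof.
rewrite /affine_subst mmapX mmap1U !mxE; congr (_ + _).
by apply: eq_bigr => j _; rewrite !mxE.
Qed.

Lemma affine_substC c : sub (mpolyC 3 c) = mpolyC 3 c.
Proof. exact: mmapC. Qed.
Lemma affine_subst0 : sub 0 = 0.
Proof. exact: rmorph0. Qed.
Lemma affine_subst1 : sub 1 = 1.
Proof. exact: rmorph1. Qed.
Lemma affine_substM f g : sub (f * g) = sub f * sub g.
Proof. exact: rmorphM. Qed.
Lemma affine_substD f g : sub (f + g) = sub f + sub g.
Proof. exact: mmapD. Qed.
Lemma affine_subst_sum (I : finType) (F : I -> mpoly 3 R) :
  sub (\sum_i F i) = \sum_i sub (F i).
Proof. exact: raddf_sum. Qed.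

Lemma affine_substE f p : peval (sub f) p = peval f (A *m p + b).
Proof.
elim/mpoly_ring_ind: f => [c|i|f g IHf IHg|f g IHf IHg].
- by rewrite affine_substC !pevalC.
- rewrite affine_subst_coord pevalD pevalC pevalX !mxE; congr (_ + _).
  by rewrite peval_sum; apply: eq_bigr => j _; rewrite pevalM pevalC pevalX.
- by rewrite affine_substD !pevalD IHf IHg.
- by rewrite affine_substM !pevalM IHf IHg.
Qed.

Lemma mderiv_affine_subst i f :
  mderiv i (sub f) = \sum_j mpolyC 3 (A j i) * sub (mderiv j f).
Proof.
elim/mpoly_ring_ind: f => [c|k|f g IHf IHg|f g IHf IHg].
- rewrite affine_substC mderivC big1 // => j _.
  by rewrite mderivC affine_subst0 mulr0.
- rewrite affine_subst_coord mderivD mderivC addr0 raddf_sum.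
  rewrite (bigD1 i) //= [RHS](bigD1 k) //= !big1 ?addr0.
  + by rewrite mderiv_mulC !mderiv_coord !eqxx affine_subst1.
  + by move=> j jk; rewrite mderiv_coord eq_sym (negPf jk) affine_subst0 mulr0.
  + by move=> j ji; rewrite mderiv_mulC mderiv_coord (negPf ji) mulr0.
- rewrite affine_substD mderivD IHf IHg -big_split; apply: eq_bigr => j _ /=.
  by rewrite mderivD affine_substD mulrDr.
- rewrite affine_substM mderivM IHf IHg mulr_suml mulr_sumr -big_split.
  apply: eq_bigr => j _ /=.
  by rewrite mderivM affine_substD !affine_substM; ring.
Qed.

Lemma grad_affine_subst f p : grad (sub f) p = A^T *m grad f (A *m p + b).
Proof.
apply/colP => i; rewrite !mxE mderiv_affine_subst peval_sum.
apply: eq_bigr => j _; rewrite pevalM pevalC !mxE.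
by rewrite affine_substE.
Qed.

Lemma hess_affine_subst f p :
  hess (sub f) p = A^T *m hess f (A *m p + b) *m A.
Proof.
apply/matrixP => i j; rewrite !mxE mderiv_affine_subst raddf_sum.
rewrite peval_sum; under eq_bigr do
  rewrite /= mderiv_mulC mderiv_affine_subst pevalM pevalC peval_sum mulr_sumr.
under [RHS]eq_bigr => l _ do rewrite !mxE mulr_suml.
rewrite exchange_big; apply: eq_bigr => k _ /=.
apply: eq_bigr => l _ /=.
by rewrite pevalM pevalC affine_substE !mxE; ring.
Qed.

Hypothesis AO : A^T *m A = 1%:M.

(** Orthogonality of A enters through the gradient, a covector, being mapped
    by the transpose of A. *)
Lemma curved_affine_subst f p :
  curved f (A *m p + b) -> curved (sub f) p.
Proof.
move=> /curvedP H; apply/curvedP => u s.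
rewrite grad_affine_subst hess_affine_subst => gu Hu.
have AO' : A *m A^T = 1%:M by apply: mulmx1C.
have [] := H (A *m u) s.
- by rewrite -gu /dot trmx_mul trmxK mulmxA.
- have := congr1 (mulmx A) Hu.
  by rewrite mulmxDr -scalemxAr !mulmxA AO' !mul1mx mulmx0.
by move=> /(congr1 (mulmx A^T)); rewrite mulmxA AO mul1mx mulmx0.
Qed.

End CurvedPoints.

Lemma affine_substK (R : realType) (A B : 'M[R]_3) (b : 'cV[R]_3)
    (f : mpoly 3 R) :
  A *m B = 1%:M -> affine_subst B (- (B *m b)) (affine_subst A b f) = f.
Proof.
move=> AB; elim/mpoly_ring_ind: f => [c|i|f g IHf IHg|f g IHf IHg].
- by rewrite !affine_substC.
- rewrite affine_subst_coord affine_substD affine_subst_sum affine_substC.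
  transitivity ((map_mx (@mpolyC 3 R) A *m
       (map_mx (@mpolyC 3 R) B *m var_col R
        + map_mx (@mpolyC 3 R) (- (B *m b))) + map_mx (@mpolyC 3 R) b) i 0).
    rewrite 2!mxE [in RHS]mxE; congr (_ + _); apply: eq_bigr => j _.
    rewrite affine_substM affine_substC affine_subst_coordE.
    by congr (_ * _); rewrite mxE.
  rewrite mulmxDr mulmxA -!map_mxM mulmxN mulmxA AB mul1mx map_mx1 mul1mx.
  by rewrite map_mxN addrNK mxE.
- by rewrite !affine_substD IHf IHg.
- by rewrite !affine_substM IHf IHg.
Qed.

Lemma irreducible_affine_subst (R : realType) (A : 'M[R]_3) (b : 'cV[R]_3)
    (f : mpoly 3 R) : A^T *m A = 1%:M ->
  irreducible_mpoly f -> irreducible_mpoly (affine_subst A b f).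
Proof.
move=> AO [f0 fU fI]; have AO' := mulmx1C AO.
pose B := A^T; pose c := - (B *m b).
have K1 h : affine_subst B c (affine_subst A b h) = h by apply: affine_substK.
have K2 h : affine_subst A b (affine_subst B c h) = h.
  rewrite -{1}(_ : - (A *m c) = b) ?affine_substK //.
  by rewrite /c mulmxN opprK mulmxA AO' mul1mx.
have U (C : 'M[R]_3) (d : 'cV[R]_3) h :
    h \is a GRing.unit -> affine_subst C d h \is a GRing.unit.
  by move=> hU; apply: rmorph_unit.
split.
- by apply: contraNneq f0 => f0; rewrite -(K1 f) f0 affine_subst0.
- by apply: contraNN fU => /(U B c); rewrite K1.
- move=> g h E; have := congr1 (affine_subst B c) E; rewrite K1 affine_substM.
  by case/fI/orP => /(U A b); rewrite K2 => ->; rewrite ?orbT.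
Qed.

(** * Curved points of an invariant surface *)

Section CurvedPointsOnInvariantSurface.
Variable R : realType.
Implicit Types (f g h : mpoly 3 R) (p u v s : 'cV[R]_3).

Definition vec3 (x y z : R) : 'cV[R]_3 := \col_i nth 0 [:: x; y; z] i.

(** [vanishing_tangent] applied to the product of h and the bordered
    determinant: h need only vanish at the curved points. *)
Lemma vanishing_curved f h p u :
  peval f p = 0 -> curved f p -> dot (grad f p) u = 0 ->
  (forall s, peval f s = 0 -> curved f s -> peval h s = 0) ->
  dot (grad h p) u = 0.
Proof.
move=> fp0 cp gu fh.
have : dot (grad (h * bordered f) p) u = 0.
  apply: (vanishing_tangent fp0 (curved_regular cp) gu) => s fs0.
  rewrite pevalM; have [->|/(fh s fs0)->] := eqVneq (peval (bordered f) s) 0;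
    by rewrite ?mulr0 ?mul0r.
rewrite dotE !mxE !mderivM !pevalD !pevalM (fh p fp0 cp) !mul0r !addr0 => E.
apply: (mulIf cp); rewrite mul0r -E dotE !mxE; ring.
Qed.

Lemma orthogonal_parallel (g v : 'cV[R]_3) : g != 0 ->
  (forall u, dot g u = 0 -> dot v u = 0) -> exists c : R, v + c *: g = 0.
Proof.
move=> /dot_gt0 g0 vu; exists (- (dot g v / dot g g)).
set w := v + _.
have gw : dot g w = 0.
  by rewrite dotDr dotZr; field; rewrite gt_eqF.
apply/eqP; apply: contraT => /dot_gt0; rewrite {2}/w dotDr dotZr.
by rewrite [dot w v]dotC vu // [dot w g]dotC gw mulr0 addr0 ltxx.
Qed.

Lemma grad_mderiv i f p : grad (mderiv i f) p = hess f p *m delta_mx i 0.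
Proof. by rewrite -colE; apply/colP => j; rewrite !mxE mderiv_comm. Qed.

Definition parabolic_field p := vec3 0 (p 0 0) (p 1 0).

Lemma parabolic_flow (a : R) p : parabolic_mx a *m p =
  p + a *: (parabolic_field p + a *: vec3 0 0 (p 0 0 / 2)).
Proof.
by apply: colP3; rewrite !mxE sum_ord3 !mxE /=; ring.
Qed.

Variable f : mpoly 3 R.
Hypothesis f_invariant :
  forall a p, peval f p = 0 -> peval f (parabolic_mx a *m p) = 0.

Lemma parabolic_field_tangent p : peval f p = 0 ->
  dot (grad f p) (parabolic_field p) = 0.
Proof.
move=> fp0; apply: (@dir_deriv_eq0 _ _ _ _ (vec3 0 0 (p 0 0 / 2))) => a.
by rewrite -parabolic_flow f_invariant.
Qed.

(** If x vanished at all curved points, the tangent plane there would be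
    x = 0, so f_y would vanish too; differentiating f_y along the surface, e2
    would be a null direction of the second fundamental form. *)
Lemma curved_off_plane p : peval f p = 0 -> curved f p ->
  exists s, [/\ peval f s = 0, curved f s & s 0 0 != 0].
Proof.
move=> fp0 cp; apply: contrapT => noS.
have x0 s : peval f s = 0 -> curved f s -> s 0 0 = 0.
  by move=> fs cs; apply: contrapT => /eqP sx; apply: noS; exists s.
have g2 s : peval f s = 0 -> curved f s -> peval (mderiv 1 f) s = 0.
  move=> fs cs; set g := grad f s.
  have : dot (grad (coord 0) s) (vec3 (g 1 0) (- g 0 0) 0) = 0.
    apply: (vanishing_curved fs cs) => [|t ft ct]; last by rewrite pevalX x0.
    by rewrite dotE !mxE /=; ring.
  rewrite dotE !mxE /= !peval_mderiv_coord /=.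
  by rewrite mul1r !mul0r !addr0.
have H2 u : dot (grad f p) u = 0 ->
    dot (hess f p *m delta_mx 1 0) u = 0.
  by move=> gu; rewrite -grad_mderiv; apply: (vanishing_curved fp0 cp gu g2).
have [c Hc] := orthogonal_parallel (curved_regular cp) H2.
have [|/colP/(_ 1)] := (curvedP _ _).1 cp _ _ _ Hc.
  by rewrite dotE !mxE /= g2 //; ring.
by rewrite !mxE eqxx => /eqP; rewrite oner_eq0.
Qed.

(** The invariance of f gives x f_y + y f_z = 0 on S.  Where f_z = 0, hence
    f_y = 0, differentiating this equation along S shows that (0, x, y) is a
    null direction of the second fundamental form. *)
Lemma curved_gradz_neq0 p : peval f p = 0 -> curved f p -> p 0 0 != 0 ->
  grad f p 2%:R 0 != 0.
Proof.
move=> fp0 cp px; apply/eqP => g3.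
have tangent_eq : p 0 0 * grad f p 1 0 + p 1 0 * grad f p 2%:R 0 = 0.
  rewrite -(parabolic_field_tangent fp0) dotE.
  by rewrite ![parabolic_field _ _ _]mxE /=; ring.
have g2 : grad f p 1 0 = 0.
  move: tangent_eq; rewrite g3 mulr0 addr0 => /eqP.
  by rewrite mulf_eq0 (negPf px) => /eqP.
have Hu u : dot (grad f p) u = 0 ->
    dot (hess f p *m parabolic_field p) u = 0.
  move=> gu.
  have <- : dot (grad (coord 0 * mderiv 1 f + coord 1 * mderiv 2%:R f) p) u
      = dot (hess f p *m parabolic_field p) u.
    move: g2 g3; rewrite !dotE !mxE !sum_ord3 !mxE /= => g2 g3.
    rewrite !mderivD !mderivM !pevalD !pevalM !peval_mderiv_coord /= !pevalX.
    rewrite g2 g3.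
    by rewrite !(mderiv_comm _ 1) !(mderiv_comm _ 2%:R); ring.
  apply: (vanishing_curved fp0 cp gu) => s fs _.
  rewrite pevalD !pevalM !pevalX -(parabolic_field_tangent fs) dotE !mxE /=.
  ring.
have [c Hc] := orthogonal_parallel (curved_regular cp) Hu.
have [|/colP/(_ 1)] := (curvedP _ _).1 cp _ _ _ Hc.
  exact: parabolic_field_tangent.
by rewrite !mxE /= => /eqP; rewrite (negPf px).
Qed.

(** Were x equal to x0 at all curved points off the plane x = 0, the function
    x (x - x0) would vanish at all curved points, and its derivative at one
    with x = x0 would force the gradient of f to be parallel to e1. *)
Lemma two_transverse_points p : peval f p = 0 -> curved f p ->
  exists q r, [/\ peval f q = 0, peval f r = 0,
    q 0 0 != 0 /\ r 0 0 != 0, q 0 0 != r 0 0 &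
    grad f q 2%:R 0 != 0 /\ grad f r 2%:R 0 != 0].
Proof.
move=> fp0 cp; have [q [fq cq qx]] := curved_off_plane fp0 cp.
have gq := curved_gradz_neq0 fq cq qx.
suff [r [fr cr rx rq]] : exists r,
    [/\ peval f r = 0, curved f r, r 0 0 != 0 & r 0 0 != q 0 0].
  by exists q, r; split; [| | |rewrite eq_sym|split=> //; apply: curved_gradz_neq0].
apply: contrapT => noR; set g := grad f q in gq.
have : dot (grad (coord 0 * (coord 0 - mpolyC 3 (q 0 0))) q)
    (vec3 (g 2%:R 0) 0 (- g 0 0)) = 0.
  apply: (vanishing_curved fq cq) => [|s fs cs].
    by rewrite dotE ![vec3 _ _ _ _ _]mxE /=; ring.
  rewrite pevalM pevalB pevalC !pevalX; apply/eqP; rewrite mulf_eq0 subr_eq0.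
  by apply: contraT; rewrite negb_or => /andP[s0 sq]; case: noR; exists s.
rewrite dotE ![vec3 _ _ _ _ _]mxE /= ![grad (_ * _) _ _ _]mxE.
rewrite !mderivM !mderivB !mderivC -(mpolyC0 3 R) !(pevalE R).
rewrite !peval_mderiv_coord /= => E.
have : q 0 0 * g 2%:R 0 = 0 by rewrite -E; ring.
by move/eqP; rewrite mulf_eq0 (negPf qx) (negPf gq).
Qed.

End CurvedPointsOnInvariantSurface.

(** * The vector field of a parabolic rotation *)

Section InfinitesimalRotation.
Variable R : realType.
Implicit Types (A n : 'M[R]_3) (b v s p : 'cV[R]_3).

(** The logarithm of [parabolic_mx 1]. *)
Definition parabolic_nil : 'M[R]_3 := delta_mx 1 0 + delta_mx 2%:R 1.

Lemma parabolic_nilE p : parabolic_nil *m p = parabolic_field p.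
Proof. by apply: colP3; rewrite !mxE sum_ord3 !mxE /=; ring. Qed.

(** The exponential of r times the affine field n s + v, when n ^+ 3 = 0 and v
    lies in the range of n. *)
Definition flow n v (r : R) s :=
  s + r *: ((n *m s + v) + r *: (2^-1 *: (n *m (n *m s + v)))).

(** The group of rotations of S about L in the original coordinates, and its
    fixed points. *)
Lemma parabolic_axis_flow (S L : set 'cV[R]_3) : parabolic_axis S L ->
  exists A v,
    [/\ A^T *m A = 1%:M,
        L = [set s | A^T *m parabolic_nil *m A *m s + v = 0] &
        forall r s, S s -> S (flow (A^T *m parabolic_nil *m A) v r s)].
Proof.
case=> _ [T [[A [b [AO _ TE]]] TL TS]].
have AO' := mulmx1C AO.
have X s : A^T *m parabolic_nil *m A *m s + A^T *m parabolic_nil *m b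
    = A^T *m (parabolic_nil *m T s).
  by rewrite TE mulmxDr mulmxDr !mulmxA.
have Tinj s s' : T s = T s' -> s = s'.
  rewrite !TE => /addIr /(congr1 (mulmx A^T)).
  by rewrite !mulmxA AO !mul1mx.
exists A, (A^T *m parabolic_nil *m b); split=> //.
- apply/seteqP; split => s /=.
    move=> Ls; have : (T @` L) (T s) by exists s.
    rewrite TL X parabolic_nilE => -[/= h0 h1].
    rewrite (_ : parabolic_field _ = 0) ?mulmx0 //.
    by apply: colP3; rewrite !mxE.
  rewrite X parabolic_nilE => /(congr1 (mulmx A)).
  rewrite mulmxA AO' mul1mx mulmx0 => /matrixP E.
  have : (T @` L) (T s).
    by rewrite TL; split; [have := E 1 0|have := E 2%:R 0]; rewrite !mxE.
  by case=> s' Ls' /Tinj <-.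
- move=> r s Ss; have : (T @` S) (parabolic_mx r *m T s).
    by rewrite -(TS r); exists (T s) => //; exists s.
  case=> s' Ss' Ts'; rewrite /flow X.
  suff <- : s' = s + r *: (A^T *m (parabolic_nil *m T s) + r *: (2^-1 *:
      (A^T *m parabolic_nil *m A *m (A^T *m (parabolic_nil *m T s))))) by [].
  apply: Tinj; rewrite Ts' [RHS]TE mulmxDr addrAC -TE parabolic_flow.
  congr (_ + _); rewrite -scalemxAr mulmxDr (mulmxA A) AO' mul1mx parabolic_nilE.
  congr (_ *: (_ + _)); rewrite -!scalemxAr !mulmxA AO' mul1mx.
  rewrite -(mulmxA parabolic_nil A A^T) AO' mulmx1 parabolic_nilE.
  congr (_ *: _).
  by apply: colP3; rewrite !mxE /=; field.
Qed.

(** Partial isometries whose kernel and cokernel are the lines of k and l. *)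
Definition corank1_isometry n := exists k l,
  [/\ n *m k = 0, n^T *m l = 0, dot k k = 1 & dot l l = 1] /\
  (n^T *m n = 1%:M - k *m k^T /\ n *m n^T = 1%:M - l *m l^T).

(** The conjugacy of n and N enters the classification only through these
    consequences. *)
Lemma nilpotent_conj_facts A (n := A^T *m parabolic_nil *m A) :
  A^T *m A = 1%:M ->
  [/\ \tr n = 0, \tr (n *m n) = 0, \tr (n^T *m n) = 2 & corank1_isometry n].
Proof.
move=> AO; have AO' := mulmx1C AO; set N := parabolic_nil in n *.
have conj (M M' : 'M[R]_3) :
    A^T *m M *m A *m (A^T *m M' *m A) = A^T *m (M *m M') *m A.
  by rewrite !mulmxA -(mulmxA _ A A^T) AO' mulmx1.
have trc (M : 'M[R]_3) : \tr (A^T *m M *m A) = \tr M.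
  by rewrite mxtrace_mulC !mulmxA AO' mul1mx.
have nT : n^T = A^T *m N^T *m A by rewrite !trmx_mul trmxK mulmxA.
have traces :
    [/\ \tr n = 0, \tr (n *m n) = 0 & \tr (n^T *m n) = 2].
  rewrite nT !conj !trc /mxtrace !sum_ord3.
  by split; rewrite /N !mxE ?sum_ord3 ?mxE /=; ring.
case: traces => tr1 trn2 trT; split=> //.
pose e (i : 'I_3) : 'cV[R]_3 := delta_mx i 0.
have ee i : dot (A^T *m e i) (A^T *m e i) = 1.
  rewrite /dot trmx_mul trmxK mulmxA -(mulmxA _ A) AO' mulmx1.
  by rewrite trmx_delta mul_delta_mx mxE.
have eeT i : (A^T *m e i) *m (A^T *m e i)^T = A^T *m delta_mx i i *m A.
  by rewrite trmx_mul trmxK trmx_delta !mulmxA -(mulmxA _ (e i)) mul_delta_mx.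
have oneE : 1%:M = A^T *m 1%:M *m A by rewrite mulmx1.
exists (A^T *m e 2%:R), (A^T *m e 0); rewrite !ee !eeT nT !conj oneE.
rewrite -!mulmxBl -!mulmxBr; split; [split=> //|split].
- rewrite !mulmxA -(mulmxA _ A A^T) AO' mulmx1 -!mulmxA.
  rewrite (_ : N *m _ = 0) ?mulmx0 //.
  by apply: colP3; rewrite /N !mxE sum_ord3 !mxE /=; ring.
- rewrite !mulmxA -(mulmxA _ A A^T) AO' mulmx1 -!mulmxA.
  rewrite (_ : N^T *m _ = 0) ?mulmx0 //.
  by apply: colP3; rewrite /N !mxE sum_ord3 !mxE /=; ring.
- congr (_ *m _ *m _); apply/matrixP; apply: ord3P; apply: ord3P;
    by rewrite /N !mxE sum_ord3 !mxE /=; ring.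
- congr (_ *m _ *m _); apply/matrixP; apply: ord3P; apply: ord3P;
    by rewrite /N !mxE sum_ord3 !mxE /=; ring.
Qed.

End InfinitesimalRotation.

(** * Two parabolic rotations of one surface *)

Section TwoRotations.
Variable R : realType.
Implicit Types (n : 'M[R]_3) (v s p : 'cV[R]_3).

(** What is left of an affine field n s + v that is tangent to the same surface
    as N without being a multiple of N. *)
Definition oblique n v : Prop :=
  [/\ n 0 1 != 0, n 0 2%:R = 0, n 1 2%:R = n 0 1, n 1 1 = 0
    & n 2%:R 2%:R = - n 0 0] /\
  [/\ n 0 1 * n 2%:R 1 = - (n 0 0 ^+ 2 + n 0 1 * n 1 0),
      n 0 1 * n 2%:R 0 = n 0 0 * (n 2%:R 1 - n 1 0),
      v 0 0 = 0 & n 0 1 * v 2%:R 0 = - n 0 0 * v 1 0].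

Lemma quartic_coef_eq0 (c0 c1 c2 c3 c4 : R) :
  (forall t, c0 + c1 * t + c2 * t ^+ 2 + c3 * t ^+ 3 + c4 * t ^+ 4 = 0) ->
  [/\ c0 = 0, c1 = 0, c2 = 0, c3 = 0 & c4 = 0].
Proof.
move=> E; have := E 0; have := E 1; have := E (-1); have := E 2; have := E (-2).
by move=> *; split; lra.
Qed.

Variable f : mpoly 3 R.
Hypothesis f_invariant :
  forall a p, peval f p = 0 -> peval f (parabolic_mx a *m p) = 0.
Variables (n : 'M[R]_3) (v : 'cV[R]_3).
Hypothesis f_flow :
  forall r s, peval f s = 0 -> peval f (flow n v r s) = 0.

Lemma parabolic_mxNK (t : R) p : parabolic_mx (- t) *m (parabolic_mx t *m p) = p.
Proof. by apply: colP3; rewrite !mxE !sum_ord3 !mxE !sum_ord3 !mxE /=; field. Qed.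

(** exp (- t N), the second group and exp (t N) preserve S in turn, so the
    derivative of their composition is tangent to S without any regularity
    assumption at the intermediate points. *)
Lemma conj_field_tangent (t : R) s : peval f s = 0 ->
  dot (grad f s) (parabolic_mx (- t) *m (n *m (parabolic_mx t *m s) + v)) = 0.
Proof.
move=> fs; set X := n *m _ + v.
apply: (@dir_deriv_eq0 _ _ _ _ (parabolic_mx (- t) *m (2^-1 *: (n *m X)))) => r.
rewrite scalemxAr -mulmxDr scalemxAr -{1}(parabolic_mxNK t s) -mulmxDr.
by apply: f_invariant; apply: f_flow; apply: f_invariant.
Qed.

(** The coefficients of t^4, t^3 and t^2 give the first three relations, those
    of t and 1 the last two.  Here k is x f_x / f_z - z; if f is written as
    F (x, q) with the invariant q = y^2 - 2 x z, this is - F_x / (2 F_q), which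
    is why it does not depend on y. *)
Lemma tangency_relations s : peval f s = 0 -> s 0 0 != 0 ->
    grad f s 2%:R 0 != 0 ->
  [/\ n 0 2%:R = 0, n 1 2%:R = n 0 1,
      (n 2%:R 2%:R - 2 * n 1 1 + n 0 0) * s 0 0 + v 0 0 = 0 &
  exists k, v 0 0 = 0 -> n 1 1 = 0 -> n 2%:R 2%:R = - n 0 0 ->
      n 0 1 * k = (n 1 0 - n 2%:R 1) * s 0 0 + v 1 0 /\
      n 0 0 * k = - n 2%:R 0 * s 0 0 - v 2%:R 0].
Proof.
move=> fs sx g3; have := parabolic_field_tangent f_invariant fs.
rewrite dotE ![parabolic_field _ _ _]mxE /= mulr0 add0r => g2.
have T t := conj_field_tangent t fs.
have {}T t := etrans (esym (dotE _ _)) (T t).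
move: (grad f s 0 0) (grad f s 1 0) (grad f s 2%:R 0) g3 g2 T => g0 g1 g2 g3 g1E T.
set x := s 0 0 in sx g1E *; set y := s 1 0 in g1E *; set z := s 2%:R 0.
pose k := x * g0 / g2.
have kE : k * g2 = x * g0 by rewrite /k; field.
set n00 := n 0 0; set n01 := n 0 1; set n02 := n 0 2%:R.
set n10 := n 1 0; set n11 := n 1 1; set n12 := n 1 2%:R.
set n20 := n 2%:R 0; set n21 := n 2%:R 1; set n22 := n 2%:R 2%:R.
pose l0 t := n00 * x + n01 * (y + t * x) + n02 * (z + t * y + t ^+ 2 * x / 2) + v 0 0.
pose l1 t := n10 * x + n11 * (y + t * x) + n12 * (z + t * y + t ^+ 2 * x / 2) + v 1 0.
pose l2 t := n20 * x + n21 * (y + t * x) + n22 * (z + t * y + t ^+ 2 * x / 2) + v 2%:R 0.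
(* the normal component at t, times x / g2; g1 is eliminated by g1E *)
have P t : k * l0 t - y * (l1 t - t * l0 t)
    + x * (l2 t - t * l1 t + t ^+ 2 / 2 * l0 t) = 0.
  apply: (mulIf g3); rewrite mul0r.
  have := T t.
  rewrite !mxE !sum_ord3 !mxE !sum_ord3 !mxE !sum_ord3 !mxE /= -/x -/y -/z
    -/n00 -/n01 -/n02 -/n10 -/n11 -/n12 -/n20 -/n21 -/n22 => E.
  transitivity (k * g2 * l0 t + - (y * g2) * (l1 t - t * l0 t)
    + x * g2 * (l2 t - t * l1 t + t ^+ 2 / 2 * l0 t)); first by ring.
  have -> : - (y * g2) = x * g1 by lra.
  by rewrite kE -[RHS](mulr0 x) -[in RHS]E /l0 /l1 /l2; field.
have [|c0 c1 c2 c3 c4] := @quartic_coef_eq0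
  (k * (n00 * x + n01 * y + n02 * z + v 0 0)
     - y * (n10 * x + n11 * y + n12 * z + v 1 0)
     + x * (n20 * x + n21 * y + n22 * z + v 2%:R 0))
  (k * (n01 * x + n02 * y) - y * (n11 * x + n12 * y - (n00 * x + n01 * y + n02 * z + v 0 0))
     + x * (n21 * x + n22 * y - (n10 * x + n11 * y + n12 * z + v 1 0)))
  (k * n02 * x / 2 - y * (n12 * x / 2 - (n01 * x + n02 * y))
     + x * (n22 * x / 2 - (n11 * x + n12 * y) + (n00 * x + n01 * y + n02 * z + v 0 0) / 2))
  (y * n02 * x / 2 + x * (- n12 * x / 2 + (n01 * x + n02 * y) / 2))
  (n02 * x ^+ 2 / 4).
  by move=> t; rewrite -(P t) /l0 /l1 /l2; field.
have n02_0 : n02 = 0.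
  by apply: (mulIf (expf_neq0 2 sx)); rewrite mul0r; lra.
have n12E : n12 = n01.
  by apply: (mulIf (expf_neq0 2 sx)); move: c3; rewrite n02_0; lra.
split=> //.
  by apply: (mulIf sx); rewrite mul0r; move: c2; rewrite n02_0 n12E; lra.
exists (k - z) => v0 n11_0 n22E; move: c0 c1.
rewrite n02_0 n12E n11_0 n22E v0 => c0 c1.
have E1 : n01 * (k - z) = (n10 - n21) * x + v 1 0.
  by apply: (mulIf sx); lra.
split=> //; apply: (mulIf sx).
have : n01 * (k - z) * y = ((n10 - n21) * x + v 1 0) * y by rewrite E1.
by lra.
Qed.

Lemma affine_coef_eq0 (x x' a b : R) : x != x' ->
  a * x + b = 0 -> a * x' + b = 0 -> a = 0 /\ b = 0.
Proof.
rewrite -subr_eq0 => xx' e e'.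
have a0 : a = 0 by apply: (mulIf xx'); lra.
by move: e; rewrite a0 => e; split=> //; lra.
Qed.

(** Relations that are affine in x and hold for two values of x split; the
    unknown k is eliminated between its two equations. *)
Lemma two_point_relations (n00 n01 n10 n11 n20 n21 n22 v0 v1 v2 x x' : R) :
  x != x' ->
  (n22 - 2 * n11 + n00) * x + v0 = 0 -> (n22 - 2 * n11 + n00) * x' + v0 = 0 ->
  n00 + n11 + n22 = 0 ->
  (forall y, y = x \/ y = x' -> exists k,
     v0 = 0 -> n11 = 0 -> n22 = - n00 ->
     n01 * k = (n10 - n21) * y + v1 /\ n00 * k = - n20 * y - v2) ->
  [/\ n11 = 0, n22 = - n00, v0 = 0,
      n01 * n20 = n00 * (n21 - n10) /\ n01 * v2 = - n00 * v1 &
      n01 = 0 -> n00 = 0 -> [/\ n21 = n10, n20 = 0, v1 = 0 & v2 = 0]].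
Proof.
move=> xx' e e' tr E; have [n11' v0E] := affine_coef_eq0 xx' e e'.
have n11E : n11 = 0 by lra.
have n22E : n22 = - n00 by lra.
have [k Ek] := E x (or_introl erefl); have [k' Ek'] := E x' (or_intror erefl).
have {Ek} [e1 e0] := Ek v0E n11E n22E.
have {Ek'} [e1' e0'] := Ek' v0E n11E n22E.
have [F1 F2] : n00 * (n10 - n21) + n01 * n20 = 0 /\ n00 * v1 + n01 * v2 = 0.
  apply: (affine_coef_eq0 xx').
  - have : n00 * (n01 * k) = n01 * (n00 * k) by ring.
    by rewrite e1 e0; lra.
  - have : n00 * (n01 * k') = n01 * (n00 * k') by ring.
    by rewrite e1' e0'; lra.
split=> //; first by split; lra.
move=> c0 b0; rewrite c0 b0 !mul0r in e1 e1' e0 e0'.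
have [n10E v1E] : n10 - n21 = 0 /\ v1 = 0.
  by apply: (affine_coef_eq0 xx'); lra.
have [n20E v2E] : n20 = 0 /\ v2 = 0 by apply: (affine_coef_eq0 xx'); lra.
by split=> //; lra.
Qed.

Hypotheses (trn : \tr n = 0) (trnn : \tr (n *m n) = 0).

Lemma second_rotation_shape p : peval f p = 0 -> curved f p ->
  (n = n 1 0 *: parabolic_nil R /\ v = 0) \/ oblique n v.
Proof.
move=> fp cp.
have [q [r [fq fr [qx rx] qr [gq gr]]]] :=
  two_transverse_points f_invariant fp cp.
have [n02 n12 E2 E] := tangency_relations fq qx gq.
have [_ _ E2' E'] := tangency_relations fr rx gr.
have tr1 : n 0 0 + n 1 1 + n 2%:R 2%:R = 0 by rewrite -trn /mxtrace sum_ord3.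
have tr2 : n 0 0 ^+ 2 + n 1 1 ^+ 2 + n 2%:R 2%:R ^+ 2
    + 2 * (n 0 1 * n 1 0 + n 0 2%:R * n 2%:R 0 + n 1 2%:R * n 2%:R 1) = 0.
  by rewrite -trnn /mxtrace sum_ord3 !mxE !sum_ord3; ring.
have [|n11 n22 v0 [F1 F2] F] := two_point_relations qr E2 E2' tr1 (n01 := n 0 1)
  (n10 := n 1 0) (n20 := n 2%:R 0) (n21 := n 2%:R 1) (v1 := v 1 0) (v2 := v 2%:R 0).
  by move=> y [->|->].
rewrite n11 n22 n12 n02 in tr2.
have [c0|c0] := eqVneq (n 0 1) 0; last first.
  right; split; split=> //.
  by move: tr2; lra.
have n00 : n 0 0 = 0.
  apply/eqP; rewrite -sqrf_eq0; apply/eqP.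
  by move: tr2; rewrite c0; lra.
have [n21 n20 v1 v2] := F c0 n00; left; split; last by apply: colP3; rewrite !mxE.
by apply/matrixP; apply: ord3P; apply: ord3P;
  rewrite ?c0 ?n02 ?n12 ?n11 ?n22 ?n00 ?n20 ?n21 !mxE /= ?c0 ?n00; ring.
Qed.

End TwoRotations.

(** * Irreducible polynomials vanishing on a quadric *)

Lemma poly_eq0_inj (D : idomainType) (P : {poly D}) (h : nat -> D) :
  injective h -> (forall k, P.[h k] = 0) -> P = 0.
Proof.
move=> hI P0; apply/eqP; apply: contraT => /max_poly_roots.
move=> /(_ [seq h k | k <- iota 0 (size P)]).
rewrite size_map size_iota ltnn; apply.
  by apply/allP => _ /mapP[k _ ->]; apply/eqP.
by rewrite map_inj_uniq ?iota_uniq.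
Qed.

Section Quadric.
Variable R : realType.
Implicit Types (s p : 'cV[R]_3).

Lemma poly_eq0_nat (P : {poly R}) : (forall x, P.[x] = 0) -> P = 0.
Proof.
move=> P0; apply: (@poly_eq0_inj _ _ (fun k => k%:R)) => // i j /eqP.
by rewrite eqr_nat => /eqP.
Qed.

Definition quad (a w : R) p : R :=
  p 1 0 ^+ 2 - 2 * p 0 0 * p 2%:R 0 - 2 * a * p 0 0 + w * p 0 0 ^+ 2.

(** Polynomials without y are coded with inner variable x and outer variable z,
    so that counting roots in one variable shows that they vanish. *)
Definition xz_poly : {poly {poly R}} -> mpoly 3 R :=
  horner_eval (coord 2%:R) \o
  map_poly (horner_eval (coord 0) \o map_poly (@mpolyC 3 R)).

HB.instance Definition _ := GRing.RMorphism.copy xz_poly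
  (horner_eval (coord 2%:R : mpoly 3 R) \o
   map_poly (horner_eval (coord 0 : mpoly 3 R) \o map_poly (@mpolyC 3 R))).

Lemma xz_polyC (c : R) : xz_poly c%:P%:P = mpolyC 3 c.
Proof. by rewrite /xz_poly /= map_polyC /= /horner_eval hornerC map_polyC hornerC. Qed.

Lemma xz_polyX : xz_poly 'X%:P = coord 0.
Proof. by rewrite /xz_poly /= map_polyC /= /horner_eval hornerC map_polyX hornerX. Qed.

Lemma xz_polyZ : xz_poly 'X = coord 2%:R.
Proof. by rewrite /xz_poly /= map_polyX /horner_eval hornerX. Qed.

Lemma peval_xz_poly A s :
  peval (xz_poly A) s = A.[(s 2%:R 0)%:P].[s 0 0].
Proof.
elim/poly_ind: A => [|A c IHA]; first by rewrite raddf0 !horner0 /peval raddf0.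
rewrite rmorphD rmorphM /= pevalD pevalM IHA xz_polyZ pevalX !hornerE /=.
congr (_ + _); elim/poly_ind: c => [|c d IHc].
  by rewrite raddf0 horner0 /peval raddf0.
rewrite polyCD polyCM rmorphD rmorphM /= pevalD pevalM IHc xz_polyX xz_polyC.
by rewrite pevalX pevalC !hornerE.
Qed.

Definition quadric (a w d : R) : mpoly 3 R :=
  coord 1 * coord 1 -
  xz_poly ((2%:R * 'X)%:P * 'X + (2 * a *: 'X - w *: 'X ^+ 2 + d%:P)%:P).

Lemma peval_quadric a w d s : peval (quadric a w d) s = quad a w s - d.
Proof.
rewrite pevalB pevalM !pevalX peval_xz_poly !hornerE /quad /=; ring.
Qed.

(** Division by a polynomial that is monic in y. *)
Lemma quadric_reduction a w d (f : mpoly 3 R) : exists g A B,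
  f = quadric a w d * g + xz_poly A + coord 1 * xz_poly B.
Proof.
rewrite /quadric; move: (_ + (_ + _%:P)%:P) => K.
elim/mpoly_ring_ind: f => [c|i|f f' [g [A [B ->]]] [g' [A' [B' ->]]]|
    f f' [g [A [B ->]]] [g' [A' [B' ->]]]].
- by exists 0, c%:P%:P, 0; rewrite xz_polyC raddf0; ring.
- elim/ord3P: i.
  + by exists 0, 'X%:P, 0; rewrite xz_polyX raddf0; ring.
  + by exists 0, 0, 1; rewrite raddf0 rmorph1; ring.
  + by exists 0, 'X, 0; rewrite xz_polyZ raddf0; ring.
- by exists (g + g'), (A + A'), (B + B'); rewrite !rmorphD; ring.
- exists (g * ((coord 1 * coord 1 - xz_poly K) * g' + xz_poly A' + coord 1 * xz_poly B')
      + g' * (xz_poly A + coord 1 * xz_poly B) + xz_poly B * xz_poly B').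
  exists (A * A' + K * (B * B')), (A * B' + A' * B).
  rewrite !rmorphD !rmorphM /=; ring.
Qed.

(** The abscissas run through the nonzero values of a nonconstant polynomial
    xi, as they do along an orbit of the second rotation; over each of them
    infinitely many zeros z are known. *)
Lemma xz_poly_eq0 (A : {poly {poly R}}) (xi : {poly R}) (z : R -> nat -> R) :
  (1 < size xi)%N ->
  (forall x, x != 0 -> injective (z x)) ->
  (forall r k, xi.[r] != 0 -> A.[(z xi.[r] k)%:P].[xi.[r]] = 0) -> A = 0.
Proof.
move=> xi1 zI A0.
have Az c : A.[c%:P] = 0.
  apply/eqP; rewrite -(comp_poly_eq0 _ xi1); apply/eqP.
  have xi0 : xi != 0 by apply: contraTneq xi1 => ->; rewrite size_poly0.
  apply: (mulIf xi0); rewrite mul0r; apply: poly_eq0_nat => r.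
  rewrite hornerM horner_comp; have [->|xr] := eqVneq xi.[r] 0.
    by rewrite mulr0.
  set x := xi.[r] in xr *.
  suff Ax : map_poly (horner_eval x) A = 0.
    have := horner_map (horner_eval x) A c%:P.
    rewrite Ax horner0 => /esym E.
    by rewrite -[(A.[c%:P]).[x]]/(horner_eval x A.[c%:P]) E mul0r.
  apply: (poly_eq0_inj (zI x xr)) => k.
  rewrite -[RHS](A0 r k xr) -/x -[RHS]/(horner_eval x _) -horner_map /=.
  by congr (_.[_]); exact: esym (hornerC _ _).
apply: (@poly_eq0_inj _ _ (fun k => k%:R%:P)) => // i j /polyC_inj /eqP.
by rewrite eqr_nat => /eqP.
Qed.

(** Reduce f modulo Q - d to A (x, z) + y B (x, z).  Over each pair (x, z) with
    x = xi r <> 0 and 2 x z + 2 a x - w x^2 + d = y^2 the surface contains both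
    points with ordinates y and - y, so A and B vanish there; hence A = B = 0
    and Q - d divides the irreducible f. *)
Lemma irreducible_quadric (f : mpoly 3 R) (a w d : R) (xi : {poly R}) :
  irreducible_mpoly f -> (1 < size xi)%N ->
  (forall r s, s 0 0 = xi.[r] -> s 0 0 != 0 -> quad a w s = d ->
     peval f s = 0) ->
  zero_set f = [set s | quad a w s = d].
Proof.
move=> [_ _ fI] xi1 f0; have [g [A [B fE]]] := quadric_reduction a w d f.
(* the ordinates are 1, 2, ..., and z is the height of the quadric *)
pose z (x : R) (k : nat) := (k.+1%:R ^+ 2 - 2 * a * x + w * x ^+ 2 - d) / (2 * x).
have qz x k : x != 0 -> quad a w (vec3 x k.+1%:R (z x k)) = d /\
                        quad a w (vec3 x (- k.+1%:R) (z x k)) = d.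
  by move=> x0; rewrite /quad !mxE /= /z; split; field.
have zI x : x != 0 -> injective (z x).
  move=> x0 i j zij; have [qi _] := qz x i x0; have [qj _] := qz x j x0.
  move: qi qj; rewrite /quad !mxE /= zij => qi qj.
  have /eqP : (i.+1%:R : R) ^+ 2 = j.+1%:R ^+ 2 by lra.
  by rewrite eqrXn2 ?ler0n // eqr_nat => /eqP[].
have AB r k : xi.[r] != 0 ->
    A.[(z xi.[r] k)%:P].[xi.[r]] = 0 /\ B.[(z xi.[r] k)%:P].[xi.[r]] = 0.
  move=> x0; set x := xi.[r] in x0 *; have [q1 q2] := qz x k x0.
  have := f0 r (vec3 x k.+1%:R (z x k)); have := f0 r (vec3 x (- k.+1%:R) (z x k)).
  rewrite ![vec3 _ _ _ 0 _]mxE /= => /(_ erefl x0 q2) e2 /(_ erefl x0 q1) e1.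
  move: e1 e2; rewrite fE !pevalD !pevalM !peval_quadric q1 q2 subrr !mul0r !add0r.
  rewrite !peval_xz_poly !pevalX !mxE /= => e1 e2.
  have k0 : (k.+1%:R : R) != 0 by rewrite pnatr_eq0.
  by split; [lra | apply: (mulfI k0); lra].
have A0 : A = 0 by apply: (xz_poly_eq0 xi1 zI) => r k /(AB r k)[].
have B0 : B = 0 by apply: (xz_poly_eq0 xi1 zI) => r k /(AB r k)[].
move: fE; rewrite A0 B0 !raddf0 mulr0 !addr0 => fE.
have gU : g \is a GRing.unit.
  have /orP[QU|//] := fI _ _ fE.
  have [q _] := qz 1 0 (oner_neq0 _).
  have := congr1 (fun h => peval h (vec3 1 1%:R (z 1 0))) (divrr QU).
  rewrite pevalM peval_quadric q subrr mul0r peval1 => /esym/eqP.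
  by rewrite oner_eq0.
apply/seteqP; split=> s /=; rewrite /zero_set /= fE pevalM peval_quadric.
  have := congr1 (fun h => peval h s) (divrr gU); rewrite pevalM peval1 => gs /eqP.
  rewrite mulf_eq0 => /orP[/eqP|/eqP gs0]; first by move/eqP; rewrite subr_eq0 => /eqP.
  by move: gs; rewrite gs0 mul0r => /esym/eqP; rewrite oner_eq0.
by move=> ->; rewrite subrr mul0r.
Qed.

End Quadric.

(** * Shape of the surface and position of the second axis *)

Section SecondAxis.
Variable R : realType.
Implicit Types (n : 'M[R]_3) (v s p : 'cV[R]_3).

Lemma quad_flow n v r s :
  oblique n v ->
  let a := v 1 0 / n 0 1 in let w := (n 2%:R 1 - n 1 0) / n 0 1 in
  quad a w (flow n v r s) = quad a w s.
Proof.
case=> [[c0 n02 n12 n11 n22] [n21 n20 v0 v2]] /=.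
rewrite /quad /flow !mxE !sum_ord3 !mxE !sum_ord3 n02 n12 n11 n22 v0.
move: (n 0 0) (n 0 1) (n 1 0) (n 2%:R 1) (n 2%:R 0) (v 1 0) (v 2%:R 0)
  (s 0 0) (s 1 0) (s 2%:R 0) c0 n21 n20 v2
  => b c n10 n21 n20 v1 v2 x y z c0 n21E n20E v2E.
have -> : n20 = b * (n21 - n10) / c by rewrite -n20E; field.
have -> : v2 = - b * v1 / c by rewrite -v2E; field.
have -> : n21 = - (b ^+ 2 + c * n10) / c by rewrite -n21E; field.
by field.
Qed.

(** The image of the z-axis under the symmetry of the level surfaces of Q that
    exchanges their two asymptotic directions in the plane y = 0. *)
Definition second_axis (a w : R) : set 'cV[R]_3 :=
  [set s | s 1 0 = 0 /\ s 2%:R 0 = w / 2 * s 0 0 - a].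

(** With b = n00 and c = n01, the lengths of the rows and columns of a partial
    isometry give n10^2 = n21^2 = 1 - b^2 - c^2, so that n20 = 0.  As
    n20 = b w, this makes b = 0 when w <> 0, and the zero set of n s + v no
    longer depends on any other parameter than a and w. *)
Lemma second_axis_kernel n v :
  corank1_isometry n ->
  \tr (n^T *m n) = 2 ->
  oblique n v ->
  let a := v 1 0 / n 0 1 in let w := (n 2%:R 1 - n 1 0) / n 0 1 in
  w != 0 -> [set s | n *m s + v = 0] = second_axis a w.
Proof.
case=> k [l [[nk nl kk ll] [nTn nnT]]] tr2.
case=> [[c0 n02 n12 n11 n22] [n21 n20 v0 v2]] a w w0.
have k1 : n 0 0 * k 0 0 + n 0 1 * k 1 0 = 0.
  by move/matrixP: nk => /(_ 0 0); rewrite !mxE sum_ord3 n02 mul0r addr0.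
have k2 : n 1 0 * k 0 0 + n 0 1 * k 2%:R 0 = 0.
  by move/matrixP: nk => /(_ 1 0); rewrite !mxE sum_ord3 n11 n12 mul0r addr0.
have l1 : n 0 1 * l 0 0 + n 2%:R 1 * l 2%:R 0 = 0.
  by move/matrixP: nl => /(_ 1 0); rewrite !mxE sum_ord3 !mxE n11 mul0r addr0.
have l2 : n 0 1 * l 1 0 - n 0 0 * l 2%:R 0 = 0.
  move/matrixP: nl => /(_ 2%:R 0).
  by rewrite !mxE sum_ord3 !mxE n02 n12 n22 mul0r add0r mulNr.
have k3 : n 0 0 ^+ 2 + n 0 1 ^+ 2 = 1 - k 2%:R 0 ^+ 2.
  move/matrixP: nTn => /(_ 2%:R 2%:R); rewrite !mxE sum_ord3 !mxE big_ord1 !mxE /=.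
  by rewrite n02 n12 n22 => E; rewrite expr2 -[RHS]E; ring.
have l3 : n 0 0 ^+ 2 + n 0 1 ^+ 2 = 1 - l 0 0 ^+ 2.
  move/matrixP: nnT => /(_ 0 0); rewrite !mxE sum_ord3 !mxE big_ord1 !mxE /=.
  by rewrite n02 => E; rewrite expr2 -[RHS]E; ring.
have t2 : 2 * n 0 0 ^+ 2 + 2 * n 0 1 ^+ 2 + n 1 0 ^+ 2 + n 2%:R 0 ^+ 2
    + n 2%:R 1 ^+ 2 = 2.
  rewrite -[RHS]tr2 /mxtrace sum_ord3 !mxE !sum_ord3 !mxE n02 n12 n11 n22; ring.
rewrite !dotE in kk ll.
have [b0 n10E] : n 0 0 = 0 /\ n 1 0 = - n 2%:R 1.
  move: w0; rewrite /w mulf_eq0 invr_eq0 (negPf c0) orbF.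
  move: (n 0 0) (n 0 1) (n 1 0) (n 2%:R 1) (n 2%:R 0) (k 0 0) (k 1 0) (k 2%:R 0)
    (l 0 0) (l 1 0) (l 2%:R 0) c0 n21 n20 k1 k2 k3 l1 l2 l3 t2 kk ll
    => b c n10 n21 n20 k0 k1 k2 l0 l1 l2 c0 n21E n20E k1E k2E k3 l1E l2E l3 t2 kk ll w0.
  have cc0 : c ^+ 2 != 0 by rewrite sqrf_eq0.
  have S0 : b ^+ 2 + c ^+ 2 != 0.
    by rewrite paddr_eq0 ?sqr_ge0 // !sqrf_eq0 (negPf c0) andbF.
  have k0c : k0 ^+ 2 = c ^+ 2.
    apply: (mulIf S0).
    have -> : k0 ^+ 2 * (b ^+ 2 + c ^+ 2) = (b * k0) ^+ 2 + c ^+ 2 * k0 ^+ 2 by ring.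
    have -> : b * k0 = - (c * k1) by lra.
    have -> : b ^+ 2 + c ^+ 2 = k0 * k0 + k1 * k1 by rewrite k3 -kk; ring.
    ring.
  have n10_2 : n10 ^+ 2 = 1 - b ^+ 2 - c ^+ 2.
    apply: (mulIf cc0); rewrite -{1}k0c -exprMn.
    have -> : n10 * k0 = - (c * k2) by lra.
    have -> : 1 - b ^+ 2 - c ^+ 2 = k2 ^+ 2 by lra.
    ring.
  have l2c : l2 ^+ 2 = c ^+ 2.
    apply: (mulIf S0).
    have -> : l2 ^+ 2 * (b ^+ 2 + c ^+ 2) = (b * l2) ^+ 2 + c ^+ 2 * l2 ^+ 2 by ring.
    have -> : b * l2 = c * l1 by lra.
    have -> : b ^+ 2 + c ^+ 2 = l1 * l1 + l2 * l2 by rewrite l3 -ll; ring.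
    ring.
  have n21_2 : n21 ^+ 2 = 1 - b ^+ 2 - c ^+ 2.
    apply: (mulIf cc0); rewrite -{1}l2c -exprMn.
    have -> : n21 * l2 = - (c * l0) by lra.
    have -> : 1 - b ^+ 2 - c ^+ 2 = l0 ^+ 2 by lra.
    ring.
  have n20_0 : n20 = 0.
    by apply/eqP; rewrite -sqrf_eq0; apply/eqP; lra.
  have b0 : b = 0.
    apply: (mulIf w0); rewrite mul0r -n20E n20_0; ring.
  split=> //; apply: (mulfI c0); move: n21E; rewrite b0; lra.
have v2E : v 2%:R 0 = 0.
  by apply: (mulfI c0); rewrite v2 b0; ring.
have n20E : n 2%:R 0 = 0.
  by apply: (mulfI c0); rewrite n20 b0; ring.
have n21_0 : n 2%:R 1 != 0.
  by apply: contraNneq w0 => e; rewrite /w n10E e oppr0 subr0 mul0r.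
have XE s : (n *m s + v = 0) <-> (s 1 0 = 0 /\
     n 1 0 * s 0 0 + n 0 1 * s 2%:R 0 + v 1 0 = 0).
  split=> [/matrixP E|[s1 s2]].
    have := E 0 0; have := E 1 0; rewrite !mxE !sum_ord3.
    rewrite n02 n11 n12 b0 v0 => e1 e0; split; last by rewrite -e1; ring.
    by apply: (mulfI c0); rewrite mulr0 -e0; ring.
  apply: colP3; rewrite !mxE sum_ord3 ?n02 ?n11 ?n12 ?n22 ?b0 ?v0 ?n20E ?v2E s1.
  - ring.
  - rewrite -[RHS]s2; ring.
  - ring.
apply/seteqP; split => s /=; rewrite /second_axis /= XE => -[-> E]; split=> //.
  apply: (mulfI c0); rewrite /w /a n10E.
  have -> : n 0 1 * s 2%:R 0 = n 2%:R 1 * s 0 0 - v 1 0.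
    by move: E; rewrite n10E; lra.
  by field.
by rewrite E /w /a n10E; field.
Qed.

(** An orbit of the second rotation reaches infinitely many abscissas, provided
    that its starting point q is not a critical point of x along X; moving q
    along the first rotation achieves this.  The orbits of the first rotation
    then sweep out the parabolas in which Q = Q q meets the planes x = const. *)
Lemma second_axis_classification (f : mpoly 3 R) (L : set 'cV[R]_3) p :
  irreducible_mpoly f ->
  (forall a s, peval f s = 0 -> peval f (parabolic_mx a *m s) = 0) ->
  peval f p = 0 -> curved f p ->
  parabolic_axis (zero_set f) L -> L <> @z_axis R ->
  exists a w d, zero_set f = [set s | quad a w s = d] /\
    (w != 0 -> L = second_axis a w).
Proof.
move=> fI finv fp cp /parabolic_axis_flow [A [v [AO LE]]].
have [trn trnn tr2 kl] := nilpotent_conj_facts AO.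
move: (A^T *m _ *m A) LE trn trnn tr2 kl => n LE trn trnn tr2 kl fflow Lz.
have fflow' r s : peval f s = 0 -> peval f (flow n v r s) = 0 by apply: fflow.
have [[nE v0]|nv] := second_rotation_shape finv fflow' trn trnn fp cp.
  case: Lz; rewrite LE v0.
  have n10 : n 1 0 != 0.
    apply/eqP => e; move: tr2; rewrite nE e scale0r mulmx0 mxtrace0 => /eqP.
    by rewrite eq_sym pnatr_eq0.
  rewrite nE; apply/seteqP; split=> s /=; rewrite addr0 -scalemxAl parabolic_nilE.
    move/eqP; rewrite scaler_eq0 (negPf n10) => /eqP/matrixP E.
    by split; [have := E 1 0|have := E 2%:R 0]; rewrite !mxE.
  by case=> s0 s1; apply: colP3; rewrite !mxE /= ?s0 ?s1 mulr0.
pose a := v 1 0 / n 0 1; pose w := (n 2%:R 1 - n 1 0) / n 0 1.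
have qflow r s : quad a w (flow n v r s) = quad a w s by apply: quad_flow.
have [[c0 n02 _ _ _] _] := nv.
have [q0 [fq0 _ qx0]] := curved_off_plane fp cp.
have [q [fq qx]] : exists q, peval f q = 0 /\ (n *m q + v) 0 0 != 0.
  have [e|e] := eqVneq ((n *m q0 + v) 0 0) 0; last by exists q0.
  exists (parabolic_mx 1 *m q0); split; first exact: finv.
  move: e; rewrite !mxE !sum_ord3 !mxE !sum_ord3 !mxE /= n02 => e.
  by apply: contra_neq (mulf_neq0 c0 qx0) => e'; lra.
exists a, w, (quad a w q); split; last first.
  by move=> w0; rewrite LE; apply: second_axis_kernel.
pose xi := (q 0 0)%:P + (n *m q + v) 0 0 *: 'X
   + ((2^-1 *: (n *m (n *m q + v))) 0 0) *: 'X^2 : {poly R}.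
have xiE r : xi.[r] = flow n v r q 0 0.
  rewrite /xi !(hornerD, hornerC, hornerZ, hornerX, hornerXn) /flow [RHS]mxE.
  rewrite [X in _ = _ + X]mxE [X in _ = _ + _ * X]mxE.
  by rewrite [X in _ = _ + _ * (_ + X)]mxE; ring.
apply: (@irreducible_quadric _ f a w _ xi fI).
  rewrite ltnNge; apply: contra qx => /leq_sizeP/(_ 1%N (leqnn _)).
  by rewrite !coefE /= => <-; apply/eqP; ring.
move=> r s sx s0 qs; set m := flow n v r q.
have fm : peval f m = 0 by apply: fflow'.
have mx : m 0 0 = s 0 0 by rewrite sx xiE.
suff -> : s = parabolic_mx ((s 1 0 - m 1 0) / s 0 0) *m m by apply: finv.
have := qs; rewrite -[RHS](qflow r) -/m /quad mx => qE; clearbody m.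
have sE : s 2%:R 0 = m 2%:R 0 + (s 1 0 ^+ 2 - m 1 0 ^+ 2) / (2 * s 0 0).
  have h2 : 2 * s 0 0 != 0 by rewrite mulf_neq0 // pnatr_eq0.
  by apply: (mulfI h2); rewrite mulrDr [X in _ + X]mulrC divfK //; lra.
by apply: colP3; rewrite !mxE sum_ord3 !mxE /= ?mx ?sE; field.
Qed.

End SecondAxis.

(** * Counting the axes *)

Lemma det_mx3 (R : comNzRingType) (M : 'M[R]_3) : \det M =
  M 0 0 * (M 1 1 * M 2%:R 2%:R - M 1 2%:R * M 2%:R 1)
  - M 0 1 * (M 1 0 * M 2%:R 2%:R - M 1 2%:R * M 2%:R 0)
  + M 0 2%:R * (M 1 0 * M 2%:R 1 - M 1 1 * M 2%:R 0).
Proof.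
have M2 (N : 'M[R]_2) : \det N = N 0 0 * N 1 1 - N 0 1 * N 1 0.
  rewrite (expand_det_row _ 0) !big_ord_recl big_ord0 /cofactor !det_mx11 !mxE.
  have E0 : (lift 0 0 : 'I_2) = 1 by apply: val_inj.
  have E1 : (lift (lift ord0 ord0) 0 : 'I_2) = 0 by apply: val_inj.
  by rewrite E1 !E0 /= /bump /=; ring.
rewrite (expand_det_row _ 0) sum_ord3 /cofactor !M2 !mxE.
have e00 : lift 0 0 = 1 :> 'I_3 by apply: val_inj.
have e01 : lift 0 1 = 2%:R :> 'I_3 by apply: val_inj.
have e10 : lift 1 0 = 0 :> 'I_3 by apply: val_inj.
have e11 : lift 1 1 = 2%:R :> 'I_3 by apply: val_inj.
have e20 : lift 2%:R 0 = 0 :> 'I_3 by apply: val_inj.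
have e21 : lift 2%:R 1 = 1 :> 'I_3 by apply: val_inj.
by rewrite e00 e01 e10 e11 e20 e21 /=; ring.
Qed.

Section AxesOfQuadrics.
Variable R : realType.
Implicit Types (S L : set 'cV[R]_3) (s p : 'cV[R]_3) (T : 'cV[R]_3 -> 'cV[R]_3).

Lemma rigid_motion_inv T : rigid_motion T ->
  exists T', [/\ rigid_motion T', cancel T T' & cancel T' T].
Proof.
case=> A [b [AO A1 TE]]; have AO' := mulmx1C AO.
exists (fun p => A^T *m p + - (A^T *m b)); split.
- by exists A^T, (- (A^T *m b)); rewrite trmxK det_tr.
- by move=> p; rewrite TE mulmxDr mulmxA AO mul1mx addrK.
- by move=> p; rewrite TE mulmxDr mulmxN !mulmxA AO' !mul1mx addrNK.
Qed.

Lemma rigid_motion_comp T T' :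
  rigid_motion T -> rigid_motion T' -> rigid_motion (T \o T').
Proof.
case=> A [b [AO A1 TE]] [A' [b' [AO' A1' TE']]].
exists (A *m A'), (A *m b' + b); split.
- by rewrite trmx_mul mulmxA -(mulmxA A'^T) AO mulmx1.
- by rewrite det_mulmx A1 A1' mulr1.
- by move=> p /=; rewrite TE TE' mulmxDr mulmxA addrA.
Qed.

Lemma image_cancel (X Y : Type) (g : X -> Y) (h : Y -> X) (D : set X) :
  cancel g h -> h @` (g @` D) = D.
Proof.
move=> gK; rewrite image_comp (_ : h \o g = id) ?image_id //.
exact/funext.
Qed.

Lemma parabolic_axis_image T S L : rigid_motion T ->
  parabolic_axis S L -> parabolic_axis (T @` S) (T @` L).
Proof.
move=> Tr [[p [v [v0 LE]]] [T0 [T0r T0L T0S]]].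
have [T' [T'r TK T'K]] := rigid_motion_inv Tr.
split.
  case: Tr => A [b [AO _ TE]]; exists (T p), (A *m v); split.
    apply: contraNneq v0 => /(congr1 (mulmx A^T)).
    by rewrite mulmxA AO mul1mx mulmx0 => ->.
  rewrite LE image_comp; congr (_ @` _); apply/funext => t /=.
  by rewrite !TE mulmxDr -scalemxAr addrAC.
exists (T0 \o T'); split; first exact: rigid_motion_comp.
  by rewrite -image_comp (image_cancel _ TK).
by rewrite -image_comp (image_cancel _ TK).
Qed.

Lemma card_parabolic_axes T S : rigid_motion T ->
  parabolic_axes (T @` S) #= parabolic_axes S.
Proof.
move=> Tr; have [T' [T'r TK T'K]] := rigid_motion_inv Tr.
have -> : parabolic_axes (T @` S) = (fun L => T @` L) @` parabolic_axes S.
  apply/seteqP; split => [M aM|_ [L aL <-]]; last exact: parabolic_axis_image.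
  exists (T' @` M); last exact: image_cancel.
  by have := parabolic_axis_image T'r aM; rewrite image_cancel.
apply: inj_card_eq => L M _ _ /(congr1 (fun D => T' @` D)).
by rewrite !image_cancel.
Qed.

Lemma quad_level_inj (a w d a' w' d' : R) :
  [set s | quad a w s = d] = [set s | quad a' w' s = d'] -> a = a' /\ w = w'.
Proof.
move=> E.
have H x : x != 0 -> 2 * a * x - w * x ^+ 2 + d = 2 * a' * x - w' * x ^+ 2 + d'.
  move=> x0; pose s := vec3 x 0 ((- 2 * a * x + w * x ^+ 2 - d) / (2 * x)).
  have : [set s | quad a w s = d] s.
    by rewrite /s /= /quad !mxE /=; field.
  by rewrite E /s /= /quad !mxE /= => <-; field.
have := H 1 (oner_neq0 _); have := H (-1); have := H 2.
rewrite oppr_eq0 oner_eq0 pnatr_eq0 => /(_ isT) h2 /(_ isT) h1 h0.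
by split; lra.
Qed.

Section Circular.
Variables (a d : R).

(** The rotation about the line x = z, y = 0, the axis of revolution of
    y^2 - 2 x z = d, of angle theta with tan (theta / 2) = sqrt 2 * k; this
    parametrization keeps the entries rational in k. *)
Definition cone_rotation (k : R) : 'M[R]_3 :=
  (1 + 2 * k ^+ 2)^-1 *: \matrix_(i, j)
   nth 0 (nth [::] [:: [:: 1; - 2 * k; 2 * k ^+ 2];
                       [:: 2 * k; 1 - 2 * k ^+ 2; - 2 * k];
                       [:: 2 * k ^+ 2; 2 * k; 1]] i) j.

(** The image of the z-axis under that rotation, at the height - a of the
    centre of the quadric. *)
Definition cone_axis (k : R) : set 'cV[R]_3 :=
  range (fun t : R => vec3 0 0 (- a) + t *: vec3 (2 * k ^+ 2) (- 2 * k) 1).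

Lemma cone_axis_parabolic k :
  parabolic_axis [set s | quad a 0 s = d] (cone_axis k).
Proof.
have q0 : 1 + 2 * k ^+ 2 != 0 by rewrite gt_eqF //; nra.
pose M := cone_rotation k.
have MO : M^T *m M = 1%:M.
  apply/matrixP; apply: ord3P; apply: ord3P;
  by rewrite !mxE sum_ord3 !mxE /=; field.
have MO' := mulmx1C MO.
pose T (p : 'cV[R]_3) := M^T *m p + M^T *m vec3 0 0 a.
have TK p : M *m T p - vec3 0 0 a = p.
  by rewrite mulmxDr !mulmxA MO' !mul1mx addrK.
have KT q : T (M *m q - vec3 0 0 a) = q.
  by rewrite /T -mulmxDr subrK mulmxA MO mul1mx.
have quadT q : quad a 0 (M *m q - vec3 0 0 a) = quad 0 0 q.
  by rewrite /quad !mxE !sum_ord3 !mxE /=; field.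
have TS : T @` [set s | quad a 0 s = d] = [set q | quad 0 0 q = d].
  apply/seteqP; split=> [_ [s /= qs <-]|q /= qq] /=.
    by rewrite -quadT TK.
  by exists (M *m q - vec3 0 0 a); rewrite ?KT //= quadT.
split.
  exists (vec3 0 0 (- a)), (vec3 (2 * k ^+ 2) (- 2 * k) 1); split=> //.
  by apply/eqP => /matrixP/(_ 2%:R 0)/eqP; rewrite !mxE /= oner_eq0.
exists T; split.
- exists M^T, (M^T *m vec3 0 0 a); rewrite trmxK; split=> //.
  by rewrite det_tr /M /cone_rotation detZ det_mx3 !mxE /=; field.
- apply/seteqP; split=> [_ [_ [t _ <-] <-]|q [/= h0 h1]] /=.
    by split; rewrite /= !mxE !sum_ord3 !mxE /=; field.
  exists (M *m q - vec3 0 0 a); last exact: KT.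
  exists (q 2%:R 0 / (1 + 2 * k ^+ 2)) => //; apply: colP3;
    by rewrite !mxE sum_ord3 !mxE /= h0 h1; field.
- move=> r; rewrite TS; apply/seteqP; split=> [_ [q /= qq <-]|q /= qq] /=.
    by rewrite -qq /quad !mxE !sum_ord3 !mxE /=; field.
  exists (parabolic_mx (- r) *m q).
    by rewrite /= -qq /quad !mxE !sum_ord3 !mxE /=; field.
  by rewrite -{1}[r]opprK parabolic_mxNK.
Qed.

Lemma infinite_cone_axes :
  infinite_set (parabolic_axes [set s | quad a 0 s = d]).
Proof.
move=> fin; apply: infinite_nat.
have <- : (fun k : nat => cone_axis k%:R) @^-1`
    parabolic_axes [set s | quad a 0 s = d] = setT.
  by apply/seteqP; split=> // k _; apply: cone_axis_parabolic.
apply: finite_preimage fin => i j _ _ E.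
have : cone_axis i%:R (vec3 0 0 (- a) + 1 *: vec3 (2 * i%:R ^+ 2) (- 2 * i%:R) 1).
  by exists 1.
rewrite E => -[t _ /matrixP e].
have := e 1 0; have := e 2%:R 0; rewrite !mxE /= => e2 e1.
have t1 : t = 1 by lra.
move: e1; rewrite t1 => e1.
have /eqP : (i%:R : R) = j%:R by lra.
by rewrite eqr_nat => /eqP.
Qed.

End Circular.

Lemma z_axis_parabolic S : (forall r s, S s -> S (parabolic_mx r *m s)) ->
  parabolic_axis S (@z_axis R).
Proof.
move=> Sinv; split.
  exists 0, (vec3 0 0 1); split.
    by apply/eqP => /matrixP/(_ 2%:R 0)/eqP; rewrite !mxE /= oner_eq0.
  apply/seteqP; split=> [s [/= s0 s1]|_ [t _ <-]].
    by exists (s 2%:R 0) => //; apply: colP3; rewrite !mxE /= ?s0 ?s1; ring.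
  by split; rewrite /= !mxE /=; ring.
exists id; split; [|by rewrite image_id|].
  by exists 1%:M, 0; rewrite trmx1 mul1mx det1; split=> // p; rewrite mul1mx addr0.
move=> r; rewrite image_id; apply/seteqP; split=> [_ [s Ss <-]|s Ss].
  exact: Sinv.
by exists (parabolic_mx (- r) *m s); [exact: Sinv|rewrite -{1}[r]opprK parabolic_mxNK].
Qed.

Lemma card_set2 (X : Type) (x y : X) : x <> y -> [set x; y] #= `I_2.
Proof.
move=> xy; apply/eq_cardSP; exists x; first by left.
rewrite (_ : _ `\ x = [set y]) ?card_set1 //.
apply/seteqP; split=> [u [[->|//]]|u ->]; first by case.
by split; [right|move=> /= e; apply: xy].
Qed.

(** The level surface determines a and w, so all axes other than the z-axis
    share the parameters found for one of them. *)
Lemma normalized_axes_count (f : mpoly 3 R) p : irreducible_mpoly f ->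
  (forall a s, peval f s = 0 -> peval f (parabolic_mx a *m s) = 0) ->
  peval f p = 0 -> curved f p ->
  let X := parabolic_axes (zero_set f) in
  X #= `I_1 \/ exists a w d,
    [/\ zero_set f = [set s | quad a w s = d], X #= `I_2 \/ infinite_set X,
        X #= `I_2 -> w != 0 & infinite_set X -> w = 0].
Proof.
move=> fI finv fp cp X.
have zX : X (@z_axis R) by apply: z_axis_parabolic.
have [allz|] := pselect (forall L, X L -> L = @z_axis R).
  left; rewrite (_ : X = [set @z_axis R]) ?card_set1 //.
  by apply/seteqP; split=> [L /allz|_ ->].
move=> /existsNP[L /not_implyP[XL Lz]]; right.
have [a [w [d [SE LE]]]] := second_axis_classification fI finv fp cp XL Lz.
exists a, w, d; have [w0|w0] := eqVneq w 0.
  have Xinf : infinite_set X by rewrite /X SE w0; apply: infinite_cone_axes.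
  split=> //; first by right.
  by move=> X2; case: Xinf; apply/finite_setP; exists 2%N.
have X2 : X #= `I_2.
  rewrite (_ : X = [set @z_axis R; L]).
    by apply: card_set2 => e; apply: Lz.
  apply/seteqP; split=> [M XM|_ [] ->] //.
  have [->|Mz] := pselect (M = @z_axis R); [by left|right].
  have [a' [w' [d' [SE' ME]]]] := second_axis_classification fI finv fp cp XM Mz.
  have [aa ww] : a = a' /\ w = w'.
    by apply: (@quad_level_inj a w d a' w' d'); rewrite -SE.
  by rewrite ME -?ww // LE // aa.
split=> //; first by left.
by case; apply/finite_setP; exists 2%N.
Qed.

End AxesOfQuadrics.

Theorem theorem15 (R : realType) (f : mpoly 3 R) (S : set 'cV[R]_3)
  (S_algebraic : S = zero_set f) (S_irreducible : irreducible_mpoly f)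
  (S_real : has_dimension S 2)
  (S_parabolic : parabolic_rotation_surface S)
  (S_curved : curvature_not_identically_zero f) :
  [\/ parabolic_axes S #= `I_1, parabolic_axes S #= `I_2
    | infinite_set (parabolic_axes S)] /\
  ((exists L1 L2 : set 'cV[R]_3,
      [/\ parabolic_axis S L1, parabolic_axis S L2 & L1 <> L2]) ->
   exists (T : 'cV[R]_3 -> 'cV[R]_3) (w delta : R),
     [/\ similarity T,
         T @` S = level_surface (model_form w) delta,
         parabolic_axes S #= `I_2 -> w != 0
       & infinite_set (parabolic_axes S) -> w = 0]).
Proof.
have [L0 [_ [T [Tr _ TS]]]] := S_parabolic.
have [p fp cp] := curved_point_exists S_curved.
have [T' [T'r TK T'K]] := rigid_motion_inv Tr.
have [B [c [BO _ T'E]]] := T'r.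
pose f' := affine_subst B c f.
have f'E s : peval f' s = peval f (T' s) by rewrite affine_substE -T'E.
have SE : T @` S = zero_set f'.
  rewrite S_algebraic; apply/seteqP; split=> [_ [s /= fs <-]|s /= f's].
    by rewrite /zero_set /= f'E TK.
  by exists (T' s); rewrite ?T'K //; rewrite /zero_set /= f'E in f's.
have f'inv a s : peval f' s = 0 -> peval f' (parabolic_mx a *m s) = 0.
  move=> f's; rewrite -[_ = _]/(zero_set f' _) -SE -(TS a) SE.
  by exists s.
have f'p : peval f' (T p) = 0 by rewrite f'E TK.
have c'p : curved f' (T p).
  by apply: curved_affine_subst; rewrite // -T'E TK.
have f'I : irreducible_mpoly f' by apply: irreducible_affine_subst.
have /= := normalized_axes_count f'I f'inv f'p c'p.
rewrite -SE; set X := parabolic_axes S.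
have XE : parabolic_axes (T @` S) #= X by apply: card_parabolic_axes.
rewrite !(card_eql XE) (eq_finite_set XE).
case=> [X1|[a [w [d [qE X2 w2 winf]]]]]; split.
- exact: Or31.
- case=> L1 [L2 [a1 a2]]; case.
  have /eq_cardSP[L XL] := X1; rewrite II0 card_eq0 => /eqP X0.
  have inX M : X M -> M = L.
    by move=> XM; apply: contrapT => ML; have : (X `\ L) M by []; rewrite X0.
  by rewrite (inX L1) // (inX L2).
- by case: X2; [exact: Or32|exact: Or33].
- move=> _; have [A [b [AO _ TE]]] := Tr.
  exists (fun s => T s + vec3 0 0 a), w, d; split=> //.
    exists 1, A, (b + vec3 0 0 a); split=> // s.
    by rewrite scale1r TE addrA.
  have mE s : model_form w (s + vec3 0 0 a) = quad a w s.
    by rewrite /model_form /quad !mxE /=; ring.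
  apply/seteqP; split=> [_ [s Ss <-]|s /= qs].
    have : (T @` S) (T s) by exists s.
    by rewrite qE /level_surface /= mE.
  have : (T @` S) (s - vec3 0 0 a).
    by rewrite qE /= -mE subrK.
  by case=> s' Ss' e; exists s' => //; rewrite e subrK.
Qed.
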